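(* The ordinary generating function $T^c(t)=\sum_{n\geq0}t^c_nt^n$, where $t^c_n$ is the number of (unlabelled) complete rooted plane $\{2,3\}$-trees with $n$ leaves, is differentially transcendental over $\mathbb{C}(t)$.
   Context: A rooted plane tree is a finite rooted tree in which the children of each vertex are linearly ordered; a leaf is a vertex with no children, and the size of a tree is its number of leaves. For a set $\mathcal{S}$ of integers $>1$, an $\mathcal{S}$-tree is a rooted plane tree in which every non-leaf vertex has $k$ children for some $k\in\mathcal{S}$. It is complete if all leaves are at the same distance from the root (the single vertex counts as a complete tree with one leaf). Differentially transcendental over $\mathbb{C}(t)$: no nonzero polynomial $P$ over $\mathbb{C}(t)$ with $P(f,f',\dots,f^{(n)})=0$. *)

(* Defs.v *)
From HB Require Import structures.
From mathcomp Require Import all_boot all_order all_algebra.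
From mathcomp Require Import generic_quotient fraction finmap complex.
From mathcomp Require Import boolp classical_sets cardinality reals.
From mathcomp Require Import mpoly.

Set Implicit Arguments.
Unset Strict Implicit.
Unset Printing Implicit Defensive.

Import GRing.Theory.
Local Open Scope ring_scope.

Inductive plane_tree : Type := Node of seq plane_tree.

Fixpoint plane_tree_rose_ind (P : plane_tree -> Prop)
    (IH : forall ts, foldr (fun t Q => P t /\ Q) True ts -> P (Node ts))
    (t : plane_tree) : P t :=
  let: Node ts := t in
  IH ts ((fix all_P (l : seq plane_tree) : foldr (fun t Q => P t /\ Q) True l :=
    if l is u :: l' then conj (plane_tree_rose_ind IH u) (all_P l') else I) ts).

Fixpoint tree_code (t : plane_tree) : GenTree.tree void :=
  let: Node ts := t in GenTree.Node 0 (map tree_code ts).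

Fixpoint tree_decode (c : GenTree.tree void) : plane_tree :=
  match c with
  | GenTree.Leaf _ => Node [::]
  | GenTree.Node _ cs => Node (map tree_decode cs)
  end.

Lemma tree_codeK : cancel tree_code tree_decode.
Proof.
elim/plane_tree_rose_ind => ts IH /=; congr Node.
by elim: ts IH => //= t ts IHts [-> /IHts->].
Qed.

HB.instance Definition _ := Countable.copy plane_tree (can_type tree_codeK).

Lemma plane_tree_indP (P : plane_tree -> Prop) :
  (forall ts, (forall t, t \in ts -> P t) -> P (Node ts)) -> forall t, P t.
Proof.
move=> IH; elim/plane_tree_rose_ind => ts IHts; apply: IH => t.
by elim: ts IHts => //= u ts IHts [Pu /IHts Pts]; rewrite inE => /predU1P[->|/Pts].
Qed.

Fixpoint num_leaves (t : plane_tree) : nat :=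
  let: Node ts := t in if nilp ts then 1%N else sumn (map num_leaves ts).

(* distances from the root to the leaves, listed from left to right *)
Fixpoint leaf_depths (t : plane_tree) : seq nat :=
  let: Node ts := t in
  if nilp ts then [:: 0%N] else map succn (flatten (map leaf_depths ts)).

Definition complete (t : plane_tree) : bool := constant (leaf_depths t).

Fixpoint is_S_tree (S : {pred nat}) (t : plane_tree) : bool :=
  let: Node ts := t in
  (nilp ts || (size ts \in S)) && all (is_S_tree S) ts.

Definition complete_trees (S : {pred nat}) (n : nat) : set plane_tree :=
  [set t | [/\ is_S_tree S t, complete t & num_leaves t = n]]%classic.

(* [fset_set] returns the empty set on an infinite set; this does not happen
   here when the elements of [S] are > 1, by [finite_complete_trees] below *)
Definition num_complete_trees (S : {pred nat}) (n : nat) : nat :=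
  #|` fset_set (complete_trees S n)|%fset.

Lemma num_leaves_gt0 t : (0 < num_leaves t)%N.
Proof.
elim/plane_tree_indP: t => -[//|t ts] IH /=.
by rewrite addn_gt0 IH ?mem_head.
Qed.

Lemma size_leaf_depths t : size (leaf_depths t) = num_leaves t.
Proof.
elim/plane_tree_indP: t => ts IH /=; case: ifP => // _.
rewrite size_map size_flatten /shape -map_comp; congr sumn.
by apply/eq_in_map => t /IH.
Qed.

Fixpoint seqs_upto (T : Type) (s : seq T) (m : nat) : seq (seq T) :=
  if m is m'.+1 then [::] :: [seq x :: l | x <- s, l <- seqs_upto s m']
  else [:: [::]].

Lemma mem_seqs_upto (T : eqType) (s : seq T) m l :
  (size l <= m)%N -> {subset l <= s} -> l \in seqs_upto s m.
Proof.
elim: m l => [|m IH] [|x l] //= sl ls.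
rewrite inE /=; apply/allpairsP; exists (x, l); split=> //=.
  by apply: ls; rewrite mem_head.
by apply: IH => // y yl; apply: ls; rewrite inE yl orbT.
Qed.

Lemma leq_size_num_leaves ts : (size ts <= sumn (map num_leaves ts))%N.
Proof.
by elim: ts => //= t ts IH; rewrite -add1n leq_add ?num_leaves_gt0.
Qed.

Lemma num_leaves_child ts t : t \in ts ->
  (num_leaves t + (size ts).-1 <= sumn (map num_leaves ts))%N.
Proof.
move=> tts; rewrite (perm_sumn (perm_map num_leaves (perm_to_rem tts))) /=.
by rewrite leq_add2l -(size_rem tts) leq_size_num_leaves.
Qed.

Lemma finite_complete_trees (S : {pred nat}) n :
  {in S, forall k, (1 < k)%N} -> finite_set (complete_trees S n).
Proof.
move=> S_gt1.
suff [s sP] : exists s : seq plane_tree, forall t,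
    is_S_tree S t -> (num_leaves t <= n)%N -> t \in s.
  apply: (sub_finite_set _ (finite_seq s)) => t /= [St _ tn].
  by apply: sP; rewrite ?tn.
elim: n => [|n [s sP]].
  by exists [::] => t _; rewrite leqNgt num_leaves_gt0.
exists (map Node (seqs_upto s n.+1)) => -[ts] /andP[ts_ok /allP Sts] tn.
apply: map_f; apply: mem_seqs_upto; move: tn => /=; case: nilP ts_ok => [-> //|_] /= /S_gt1 ts_gt1 tn.
  exact: leq_trans (leq_size_num_leaves ts) tn.
move=> t tts; apply: sP; first exact: Sts.
rewrite -ltnS; apply: leq_trans tn; apply: leq_trans (num_leaves_child tts).
by rewrite -addn1 leq_add2l; case: (size ts) ts_gt1 => [|[]].
Qed.

Record fps (K : Type) : Type := FPS { fps_coef : nat -> K }.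

Section FpsRing.
Variable K : fieldType.
Implicit Types f g h : fps K.

HB.instance Definition _ := [isNew for @fps_coef K].
HB.instance Definition _ := [Choice of fps K by <:].

Lemma fpsP f g : (forall n, fps_coef f n = fps_coef g n) -> f = g.
Proof. by move=> fg; apply: val_inj; apply: funext. Qed.

Definition fps_const (c : K) : fps K := FPS (fun n => if n == 0%N then c else 0).
Definition fps_add f g := FPS (fun n => fps_coef f n + fps_coef g n).
Definition fps_opp f := FPS (fun n => - fps_coef f n).
Definition fps_mul f g :=
  FPS (fun n => \sum_(i < n.+1) fps_coef f i * fps_coef g (n - i)).

Fact fps_addA : associative fps_add.
Proof. by move=> f g h; apply: fpsP => n /=; rewrite addrA. Qed.
Fact fps_addC : commutative fps_add.
Proof. by move=> f g; apply: fpsP => n /=; rewrite addrC. Qed.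
Fact fps_add0 : left_id (fps_const 0) fps_add.
Proof. by move=> f; apply: fpsP => n /=; rewrite if_same add0r. Qed.
Fact fps_addN : left_inverse (fps_const 0) fps_opp fps_add.
Proof. by move=> f; apply: fpsP => n /=; rewrite if_same addNr. Qed.

HB.instance Definition _ :=
  GRing.isZmodule.Build (fps K) fps_addA fps_addC fps_add0 fps_addN.

Fact fps_mulC : commutative fps_mul.
Proof.
move=> f g; apply: fpsP => n /=; rewrite (reindex_inj rev_ord_inj) /=.
by apply: eq_bigr => i _; rewrite mulrC subSS subKn // -ltnS.
Qed.

Fact fps_mulA : associative fps_mul.
Proof.
move=> f g h; apply: fpsP => n; rewrite [fps_mul g h]fps_mulC.
rewrite [fps_mul (fps_mul f g) h]fps_mulC /=.
pose c j k := fps_coef f j * (fps_coef h k * fps_coef g (n - j - k)).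
transitivity (\sum_(j < n.+1) \sum_(k < n.+1 | (k <= n - j)%N) c j k).
  apply: eq_bigr => /= j _; rewrite big_distrr /=.
  by rewrite (big_ord_narrow_leq (leq_subr _ _)).
rewrite (exchange_big_dep predT) //=; apply: eq_bigr => k _.
transitivity (\sum_(j < n.+1 | (j <= n - k)%N) c j k).
  apply: eq_bigl => j; rewrite -ltnS -(ltnS j) -!subSn ?leq_ord //.
  by rewrite -subn_gt0 -(subn_gt0 j) -!subnDA addnC.
rewrite (big_ord_narrow_leq (leq_subr _ _)) big_distrr /=.
by apply: eq_bigr => j _; rewrite /c /= mulrCA subnAC.
Qed.

Fact fps_const_mul c f n :
  fps_coef (fps_mul (fps_const c) f) n = c * fps_coef f n.
Proof. by rewrite /= big_ord_recl subn0 big1 ?addr0 //= => i _; rewrite mul0r. Qed.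

Fact fps_mul1 : left_id (fps_const 1) fps_mul.
Proof. by move=> f; apply: fpsP => n; rewrite fps_const_mul mul1r. Qed.
Fact fps_mulDl : left_distributive fps_mul fps_add.
Proof.
move=> f g h; apply: fpsP => n /=; rewrite -big_split /=.
by apply: eq_bigr => i _; rewrite mulrDl.
Qed.
Fact fps_1neq0 : fps_const 1 != 0.
Proof.
by apply/eqP => /(congr1 (@fps_coef K ^~ 0%N)) /= /eqP; rewrite oner_eq0.
Qed.

HB.instance Definition _ := GRing.Zmodule_isComNzRing.Build (fps K)
  fps_mulA fps_mulC fps_mul1 fps_mulDl fps_1neq0.

Lemma fps_coefM f g n : fps_coef (f * g) n =
  \sum_(i < n.+1) fps_coef f i * fps_coef g (n - i).
Proof. by []. Qed.

Definition fps_unit : pred (fps K) := fun f => fps_coef f 0 != 0.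

(* the first [n] coefficients of the inverse of [f], solved for recursively *)
Fixpoint fps_inv_seq f (n : nat) : seq K :=
  if n is m.+1 then
    let s := fps_inv_seq f m in
    rcons s ((fps_coef f 0)^-1 *
      ((m == 0%N)%:R - \sum_(i < m) fps_coef f i.+1 * s`_(m - i.+1)))
  else [::].

Definition fps_inv f : fps K :=
  if fps_unit f then FPS (fun n => (fps_inv_seq f n.+1)`_n) else f.

Fact size_fps_inv_seq f n : size (fps_inv_seq f n) = n.
Proof. by elim: n => //= n IH; rewrite size_rcons IH. Qed.

Fact nth_fps_inv_seq f n k : (k < n)%N ->
  (fps_inv_seq f n)`_k = (fps_inv_seq f k.+1)`_k.
Proof.
elim: n => // n IH; rewrite ltnS leq_eqVlt => /orP[/eqP->//|kn].
by rewrite [LHS]/= nth_rcons size_fps_inv_seq kn IH.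
Qed.

Fact fps_mulVf : {in fps_unit, left_inverse 1 fps_inv *%R}.
Proof.
move=> f fu; rewrite mulrC; apply: fpsP => n; rewrite fps_coefM.
have f0 : fps_coef f 0 != 0 by [].
rewrite /fps_inv ifT // big_ord_recl subn0 /=.
rewrite nth_rcons size_fps_inv_seq ltnn eqxx mulVKf //.
under [X in _ + X]eq_bigr => i _ do
  rewrite /bump add1n -[rcons _ _]/(fps_inv_seq f _.+1)
    -(@nth_fps_inv_seq f n) ?ltn_subrL ?(leq_ltn_trans _ (ltn_ord i)) //.
by rewrite subrK; case: eqP.
Qed.

Fact fps_unitPl f g : g * f = 1 -> fps_unit f.
Proof.
move=> /(congr1 (@fps_coef K ^~ 0%N)); rewrite fps_coefM big_ord1 /= => gf.
by apply/eqP => f0; move: gf => /eqP; rewrite f0 mulr0 eq_sym oner_eq0.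
Qed.

Fact fps_inv_out : {in [predC fps_unit], fps_inv =1 id}.
Proof. by move=> f; rewrite inE /fps_inv => /negPf fu; rewrite [fps_unit f]fu. Qed.

HB.instance Definition _ := GRing.ComNzRing_hasMulInverse.Build (fps K)
  fps_mulVf fps_unitPl fps_inv_out.

Fact fps_idomain : GRing.integral_domain_axiom (fps K).
Proof.
move=> f g fg0; case: eqVneq => //= f0; case: eqVneq => //= g0; exfalso.
have ex h : h != 0 -> exists n, fps_coef h n != 0.
  move=> h0; apply: contrapT => hn; case/eqP: h0; apply: fpsP => n /=.
  by rewrite if_same; apply/eqP/negPn/negP => hn0; apply: hn; exists n.
have /ex_minnP[a fa mina] := ex _ f0; have /ex_minnP[b gb minb] := ex _ g0.
have ab : (a < (a + b).+1)%N by rewrite ltnS leq_addr.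
have := congr1 (@fps_coef K ^~ (a + b)%N) fg0.
rewrite fps_coefM (bigD1 (Ordinal ab)) //= addKn big1 ?addr0 => [|i].
  by rewrite if_same => /eqP; rewrite mulf_eq0 (negPf fa) (negPf gb).
rewrite -val_eqE /= neq_ltn => /orP[ia|ai].
  have /eqP-> : fps_coef f i == 0; last by rewrite mul0r.
  by apply: contraTT ia => /mina; rewrite -leqNgt.
have /eqP-> : fps_coef g (a + b - i) == 0; last by rewrite mulr0.
apply: contraTT ai => /minb; rewrite -leqNgt; have := ltn_ord i; rewrite ltnS => iab.
by rewrite leq_subRL // leq_add2r.
Qed.

HB.instance Definition _ :=
  GRing.ComUnitRing_isIntegral.Build (fps K) fps_idomain.

Definition fps_deriv f : fps K := FPS (fun n => fps_coef f n.+1 *+ n.+1).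

Definition poly_fps (p : {poly K}) : fps K := FPS (fun n => p`_n).

Fact poly_fps_is_zmod_morphism : zmod_morphism poly_fps.
Proof. by move=> p q; apply: fpsP => n /=; rewrite coefB. Qed.
Fact poly_fps_is_monoid_morphism : monoid_morphism poly_fps.
Proof.
split; first by apply: fpsP => n /=; rewrite coef1; case: eqP.
by move=> p q; apply: fpsP => n /=; rewrite coefM.
Qed.

HB.instance Definition _ := GRing.isZmodMorphism.Build {poly K} (fps K)
  poly_fps poly_fps_is_zmod_morphism.
HB.instance Definition _ := GRing.isMonoidMorphism.Build {poly K} (fps K)
  poly_fps poly_fps_is_monoid_morphism.

Lemma poly_fps_inj : injective poly_fps.
Proof.
move=> p q pq; apply/polyP => n.
by move: pq => /(congr1 (fun f => fps_coef f n)).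
Qed.

End FpsRing.

(* [laurent K] is the field K((t)), built as the fraction field of K[[t]], and
   [ratfun K] is K(t) *)
Notation laurent K := {fraction (fps K)}.
Notation ratfun K := {fraction {poly K}}.
Notation tofrac := (@FracField.tofrac _).

Section RatfunLaurent.
Variable K : fieldType.

(* expansion at 0 of a rational function: the embedding of K(t) into K((t)) *)
Definition ratfun_laurent (x : ratfun K) : laurent K :=
  tofrac (poly_fps \n_(repr x)) / tofrac (poly_fps \d_(repr x)).

Lemma ratfun_numden (x : ratfun K) :
  x * tofrac \d_(repr x) = tofrac \n_(repr x).
Proof.
rewrite -{1}[x]reprK; unlock FracField.tofrac; rewrite -[LHS]FracField.pi_mul.
apply/eqmodP; rewrite /= FracField.equivfE /FracField.mulf /=.
by rewrite !numden_Ratio ?mulr1 ?oner_eq0 ?denom_ratioP // mulrC.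
Qed.

Let laurent_eq0 (q : {poly K}) : (tofrac (poly_fps q) == 0) = (q == 0).
Proof. by rewrite tofrac_eq0 -(rmorph0 (@poly_fps K)) (inj_eq (@poly_fps_inj K)). Qed.

Lemma ratfun_laurentP (x : ratfun K) (p q : {poly K}) : q != 0 ->
  x * tofrac q = tofrac p ->
  ratfun_laurent x = tofrac (poly_fps p) / tofrac (poly_fps q).
Proof.
move=> q0 xqp; apply/eqP; rewrite eqr_div ?laurent_eq0 ?denom_ratioP //.
rewrite -!tofracM -!(rmorphM (@poly_fps K)).
apply/eqP; congr (tofrac (poly_fps _)); apply/eqP.
by rewrite -tofrac_eq !tofracM -xqp -ratfun_numden mulrAC.
Qed.

Fact ratfun_laurent_is_zmod_morphism : zmod_morphism ratfun_laurent.
Proof.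
move=> x y; have q0 := denom_ratioP (repr x); have s0 := denom_ratioP (repr y).
rewrite (@ratfun_laurentP _ (\n_(repr x) * \d_(repr y) - \n_(repr y) * \d_(repr x))
  (\d_(repr x) * \d_(repr y))) ?mulf_neq0 //.
  rewrite (rmorphB (@poly_fps K)) !(rmorphM (@poly_fps K)) tofracB !tofracM.
  by rewrite -mulNr -addf_div ?laurent_eq0 // mulNr.
rewrite tofracB !tofracM -!ratfun_numden mulrBl !mulrA; congr (_ - _).
by rewrite mulrAC.
Qed.

Fact ratfun_laurent_is_monoid_morphism : monoid_morphism ratfun_laurent.
Proof.
split=> [|x y].
  rewrite (@ratfun_laurentP _ 1 1) ?oner_eq0 // ?tofrac1 ?mulr1 //.
  by rewrite (rmorph1 (@poly_fps K)) tofrac1 divr1.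
rewrite (@ratfun_laurentP _ (\n_(repr x) * \n_(repr y))
  (\d_(repr x) * \d_(repr y))) ?mulf_neq0 ?denom_ratioP //.
  by rewrite !(rmorphM (@poly_fps K)) !tofracM -mulf_div.
by rewrite !tofracM -!ratfun_numden mulrACA.
Qed.

HB.instance Definition _ := GRing.isZmodMorphism.Build (ratfun K) (laurent K)
  ratfun_laurent ratfun_laurent_is_zmod_morphism.
HB.instance Definition _ := GRing.isMonoidMorphism.Build (ratfun K) (laurent K)
  ratfun_laurent ratfun_laurent_is_monoid_morphism.

End RatfunLaurent.

Definition differentially_transcendental (K : fieldType) (f : fps K) : Prop :=
  forall (n : nat) (P : {mpoly (ratfun K)[n.+1]}), P != 0 ->
    (map_mpoly (@ratfun_laurent K) P).@[fun i : 'I_n.+1 =>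
       tofrac (iter i (@fps_deriv K) f)] != 0.

Definition generating_function (K : fieldType) (a : nat -> nat) : fps K :=
  FPS (fun n => (a n)%:R).

(* Main.v *)
Require Import Defs.
From HB Require Import structures.
From mathcomp Require Import all_boot all_order all_algebra.
From mathcomp Require Import fraction finmap complex.
From mathcomp Require Import boolp classical_sets cardinality reals.
From mathcomp Require Import mpoly ring zify.

Set Implicit Arguments.
Unset Strict Implicit.
Unset Printing Implicit Defensive.

(* Let R = t^2 + t^3. Decomposing a complete tree at its root shows that the generating
   polynomial of the complete trees of height h is the h-th iterate of R, so
   f = T^c is the sum of these iterates and f o R = f - t.

   Put theta = t d/dt and z_i = theta^i f. Composition with R acts on polynomials in the
   z_i over C(t): it sends t to R and z_i to a combination of z_i, ..., z_0 minus a rational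
   function. If the z_i were algebraically dependent, a relation P with least leading monomial
   would be an eigenvector, u P = S(P). Taking partial derivatives of order deg P - 1
   yields a system of equations for the coefficients of affine forms. At t = infinity,
   where R ~ t^3, the action on the z_i becomes diagonal with distinct entries 3^(-i), and
   comparing leading coefficients shows that the system has no solution: degrees are
   multiplied by 3, so the degree 3N + 1 produced by the inhomogeneous term t cannot be
   matched. *)

Import Order.TTheory GRing.Theory Num.Theory.
Local Open Scope ring_scope.

(** * Values of rational functions at infinity *)

Section TopCoefficient.
Variable A : nzRingType.
Implicit Types p q : {poly A}.

Lemma size_mul_leq_add p q m n :
  (size p <= m.+1)%N -> (size q <= n.+1)%N -> (size (p * q)%R <= (m + n).+1)%N.
Proof.
move=> pm qn; apply: leq_trans (size_polyMleq p q) _; rewrite -subn1.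
by rewrite (leq_trans (leq_sub2r 1 (leq_add pm qn))) ?subn1 //= addnS.
Qed.

Lemma coefM_top p q m n : (size p <= m.+1)%N -> (size q <= n.+1)%N ->
  (p * q)`_(m + n) = p`_m * q`_n.
Proof.
move=> pm qn; rewrite coefM (bigD1 (inord m)) //= inordK ?ltnS ?leq_addr //.
rewrite addKn big1 ?addr0 // => i; rewrite -val_eqE /= inordK ?ltnS ?leq_addr //.
rewrite neq_ltn => /orP[im|mi].
  rewrite [q`__]nth_default ?mulr0 //; apply: leq_trans qn _.
  by rewrite ltn_subRL ltn_add2r.
by rewrite [p`__]nth_default ?mul0r // (leq_trans pm).
Qed.

End TopCoefficient.

Section Infinity.
Variable C : fieldType.
Implicit Types (p q : {poly C}) (x y : ratfun C) (c d : C).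

(* [x] is regular at infinity and takes the value [c] there *)
Definition infval x c := exists p q m,
  [/\ size q = m.+1, x * tofrac q = tofrac p, (size p <= m.+1)%N & p`_m = c * q`_m].

Lemma infval_div p q m c : size q = m.+1 -> (size p <= m.+1)%N ->
  p`_m = c * q`_m -> infval (tofrac p / tofrac q) c.
Proof.
move=> sq sp pc; exists p, q, m; split=> //.
by rewrite divfK // tofrac_eq0 -size_poly_eq0 sq.
Qed.

Lemma infvalC c : infval (tofrac c%:P) c.
Proof.
have := @infval_div c%:P 1 0%N c; rewrite tofrac1 divr1; apply.
- by rewrite size_poly1.
- exact: size_polyC_leq1.
- by rewrite coefC coef1 mulr1.
Qed.

Lemma infval0 : infval 0 0.
Proof. by have := infvalC 0; rewrite polyC0 tofrac0. Qed.

Lemma infvalD x y c d : infval x c -> infval y d -> infval (x + y) (c + d).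
Proof.
move=> [p [q [m [sq xq sp pc]]]] [p' [q' [m' [sq' yq sp' pc']]]].
exists (p * q' + p' * q), (q * q'), (m + m')%N; split.
- by rewrite size_mul -?size_poly_eq0 ?sq ?sq' // addSn addnS.
- by rewrite tofracD !tofracM -xq -yq; ring.
- rewrite (leq_trans (size_polyD _ _)) // geq_max.
  by rewrite size_mul_leq_add ?sq' // addnC size_mul_leq_add ?sq.
- rewrite coefD; have -> : (p' * q)`_(m + m') = p'`_m' * q`_m by rewrite addnC coefM_top ?sq.
  by rewrite !coefM_top ?sq ?sq' // pc pc'; ring.
Qed.

Lemma infvalM x y c d : infval x c -> infval y d -> infval (x * y) (c * d).
Proof.
move=> [p [q [m [sq xq sp pc]]]] [p' [q' [m' [sq' yq sp' pc']]]].
exists (p * p'), (q * q'), (m + m')%N; split.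
- by rewrite size_mul -?size_poly_eq0 ?sq ?sq' // addSn addnS.
- by rewrite !tofracM -xq -yq; ring.
- exact: size_mul_leq_add.
- by rewrite !coefM_top ?sq ?sq' // pc pc'; ring.
Qed.

Lemma infvalN x c : infval x c -> infval (- x) (- c).
Proof.
move=> xc; rewrite -mulN1r -[- c]mulN1r; apply: infvalM => //.
by have := infvalC (-1); rewrite polyCN tofracN tofrac1.
Qed.

Lemma infvalB x y c d : infval x c -> infval y d -> infval (x - y) (c - d).
Proof. by move=> xc /infvalN; apply: infvalD. Qed.

Lemma infvalX x c n : infval x c -> infval (x ^+ n) (c ^+ n).
Proof.
move=> xc; elim: n => [|n IH]; last by rewrite !exprS; apply: infvalM.
by have := infvalC 1; rewrite tofrac1.
Qed.

Lemma infval_sum (I : finType) (F : I -> ratfun C) (G : I -> C) :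
  (forall i, infval (F i) (G i)) -> infval (\sum_i F i) (\sum_i G i).
Proof.
move=> FG; elim/big_rec2: _ => [|i x c _]; first exact: infval0.
exact: infvalD.
Qed.

Lemma infval_inj x c d : infval x c -> infval x d -> c = d.
Proof.
move=> xc /(infvalB xc); rewrite subrr => -[p [q [m [sq xq _]]]].
move/esym/eqP: xq; rewrite mul0r tofrac_eq0 => /eqP->.
rewrite coef0 => /esym/eqP; rewrite mulf_eq0 subr_eq0 => /orP[/eqP//|].
by rewrite -[m]/(m.+1.-1) -sq -lead_coefE lead_coef_eq0 -size_poly_eq0 sq.
Qed.

Lemma infvalV x c : c != 0 -> infval x c -> infval x^-1 c^-1.
Proof.
move=> c0 [p [q [m [sq xq sp pc]]]].
have qm0 : q`_m != 0.
  by rewrite -[m]/(m.+1.-1) -sq -lead_coefE lead_coef_eq0 -size_poly_eq0 sq.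
have szp : size p = m.+1.
  apply/eqP; rewrite eqn_leq sp ltnNge; apply/negP => /leq_sizeP /(_ m (leqnn m)).
  by rewrite pc => /eqP; rewrite mulf_eq0 (negPf c0) (negPf qm0).
have q0 : tofrac q != 0 by rewrite tofrac_eq0 -size_poly_eq0 sq.
have -> : x^-1 = tofrac q / tofrac p by rewrite -xq invfM mulrCA divff ?mulr1.
by apply: (infval_div szp); rewrite ?sq // pc mulKf.
Qed.

Lemma infvalXV : infval (tofrac 'X)^-1 0.
Proof.
have := @infval_div 1 'X 1 0; rewrite tofrac1 mul1r; apply.
- exact: size_polyX.
- by rewrite size_poly1.
- by rewrite coef1 mul0r.
Qed.

Lemma infval_divXn p m : (size p <= m.+1)%N ->
  infval (tofrac p / tofrac 'X ^+ m) p`_m.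
Proof.
move=> sp; rewrite -tofracXn; apply: (@infval_div _ _ m) => //.
  by rewrite size_polyXn.
by rewrite coefXn eqxx mulr1.
Qed.

End Infinity.

(** * Substitution of t^2 + t^3 into differential polynomials *)

Definition branching (C : nzRingType) : {poly C} := 'X^2 + 'X^3.

Section BranchingSubstitution.
Variable C : fieldType.
Implicit Type p : {poly C}.

Lemma size_branching : size (branching C) = 4%N.
Proof. by rewrite /branching addrC size_polyDl ?size_polyXn. Qed.

Lemma lead_coef_branching : lead_coef (branching C) = 1.
Proof. by rewrite /branching addrC lead_coefDl ?size_polyXn // lead_coefXn. Qed.

Lemma size_comp_branching p m : (size p <= m.+1)%N ->
  (size (p \Po branching C) <= (3 * m).+1)%N.
Proof.
move=> pm; have := size_comp_poly p (branching C); rewrite size_branching /=.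
by move: pm; do 2!move: (size _) => ?; lia.
Qed.

Lemma coef_comp_branching p m : (size p <= m.+1)%N ->
  (p \Po branching C)`_(3 * m) = p`_m.
Proof.
rewrite leq_eqVlt => /orP[/eqP pm|pm].
  have := lead_coef_comp p (_ : 1 < size (branching C))%N.
  rewrite lead_coef_branching expr1n mulr1 !lead_coefE size_comp_poly.
  by rewrite pm size_branching mulnC; apply.
rewrite [RHS]nth_default //; case: m pm => [|m] pm.
  by move: pm; rewrite ltnS leqn0 size_poly_eq0 => /eqP->; rewrite comp_poly0 coef0.
by rewrite nth_default // (leq_trans (size_comp_branching pm)) //; lia.
Qed.

End BranchingSubstitution.

Section SemilinearSubstitution.
Variables (A : comNzRingType) (K : comNzRingType) (f : {rmorphism A -> K}) (n : nat).
Variables (rho : 'I_n -> 'I_n -> K) (e : 'I_n -> K).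
Implicit Type P : {mpoly A[n]}.

Definition subst_var (i : 'I_n) : {mpoly K[n]} :=
  \sum_j rho i j *: 'X_j - (e i)%:MP.

Definition semisubst P : {mpoly K[n]} := mmap (@mpolyC n K \o f) subst_var P.

HB.instance Definition _ := GRing.RMorphism.copy semisubst
  (mmap (@mpolyC n K \o f) subst_var).

Lemma semisubstC a : semisubst a%:MP = (f a)%:MP.
Proof. exact: mmapC. Qed.

Lemma semisubstXU i : semisubst 'X_i = subst_var i.
Proof. by rewrite /semisubst mmapX mmap1U. Qed.

Lemma mderivXU (B : comNzRingType) (i j : 'I_n) :
  'X_j^`M(i) = (i == j)%:R%:MP :> {mpoly B[n]}.
Proof.
rewrite mderivX mnm1E; case: (j =P i) => [->|/nesym/eqP/negPf->].
  have -> : (U_(i) - U_(i) = 0 :> 'X_{1..n})%MM.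
    by apply/mnmP => k; rewrite mnmBE subnn mnm0E.
  by rewrite mpolyX0 eqxx scale1r mpolyC1.
by rewrite scale0r mpolyC0.
Qed.

Lemma mderiv_semisubst j P :
  (semisubst P)^`M(j) = \sum_i rho i j *: semisubst P^`M(i).
Proof.
pose chain P := (semisubst P)^`M(j) = \sum_i rho i j *: semisubst P^`M(i).
have chainD P1 P2 : chain P1 -> chain P2 -> chain (P1 + P2).
  rewrite /chain rmorphD mderivD => -> ->; rewrite -big_split /=.
  by apply: eq_bigr => i _; rewrite mderivD rmorphD scalerDr.
have chainM P1 P2 : chain P1 -> chain P2 -> chain (P1 * P2).
  rewrite /chain rmorphM mderivM => -> ->.
  rewrite mulr_suml mulr_sumr -big_split /=; apply: eq_bigr => i _.
  by rewrite mderivM rmorphD !rmorphM scalerDr scalerAl scalerAr.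
have chainC c : chain c%:MP.
  rewrite /chain semisubstC mderivC big1 // => i _.
  by rewrite mderivC rmorph0 scaler0.
have chainX i : chain 'X_i.
  rewrite /chain semisubstXU mderivB mderivC subr0 raddf_sum /=.
  rewrite (bigD1 j) //= [RHS](bigD1 i) //= !big1 ?addr0.
  - by rewrite mderivZ !mderivXU !eqxx mpolyC1 rmorph1.
  - by move=> k /negPf ki; rewrite mderivXU ki mpolyC0 rmorph0 scaler0.
  - by move=> k; rewrite eq_sym => /negPf kj; rewrite mderivZ mderivXU kj mpolyC0 scaler0.
suff : chain P by [].
elim/mpolyind: P => [|c m P _ _ IH]; first by rewrite -mpolyC0; apply/chainC.
apply/chainD => //; rewrite -mul_mpolyC; apply/chainM; first exact: chainC.
rewrite mpolyXE_id; elim/big_rec: _ => [|i Q _]; first by rewrite -mpolyC1; apply/chainC.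
apply/chainM; elim: (m i) => [|k IHk]; first by rewrite expr0 -mpolyC1; apply/chainC.
by rewrite exprS; apply/chainM.
Qed.
End SemilinearSubstitution.

Section SemilinearDescent.
Variables (A K : comNzRingType) (f g : {rmorphism A -> K}) (n : nat).
Variables (rho : 'I_n -> 'I_n -> K) (e : 'I_n -> K).
Local Notation S := (semisubst f rho e).
Implicit Type Q : {mpoly A[n]}.

Lemma mpoly_affineE Q : (forall m, (1 < mdeg m)%N -> Q@_m = 0) ->
  Q = (Q@_0)%:MP + \sum_i (Q@_U_(i))%:MP * 'X_i.
Proof.
move=> Q1; apply/mpolyP => m; rewrite mcoeffD mcoeffC raddf_sum /=.
have E i : ((Q@_U_(i))%:MP * 'X_i)@_m = Q@_U_(i) * (U_(i)%MM == m)%:R.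
  by rewrite mcoeffCM mcoeffX.
under eq_bigr => i _ do rewrite E.
case: (ltngtP (mdeg m) 1) => m1.
- have /eqP -> : m == 0%MM by rewrite -mdeg_eq0 -leqn0 -ltnS.
  rewrite eqxx mulr1 big1 ?addr0 // => i _.
  by rewrite (_ : (_ == _) = false) ?mulr0 // -mdeg_eq0 mdeg1.
- have -> : (m == 0%MM) = false.
    by apply/negbTE; rewrite -mdeg_eq0 -lt0n (ltn_trans _ m1).
  rewrite Q1 // mulr0 add0r big1 // => i _.
  by case: eqP m1 => [<-|]; rewrite ?mdeg1 ?mulr0.
- have /mdeg1P[i /eqP->] : mdeg m == 1%N by rewrite m1.
  rewrite (bigD1 i) //= eqxx mulr1 big1 => [|j /negPf ji].
    by rewrite addr0 -mdeg_eq0 mdeg1 mulr0 add0r.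
  case: eqP => [/mnmP/(_ i)|]; rewrite ?mulr0 //.
  by rewrite !mnm1E ji eqxx.
Qed.

Lemma mcoeffU_subst_var i j : (subst_var rho e i)@_U_(j) = rho i j.
Proof.
rewrite mcoeffB mcoeffC -mdeg_eq0 mdeg1 mulr0 subr0 raddf_sum /=.
rewrite (bigD1 j) //= mcoeffZ mcoeffX eqxx mulr1 big1 ?addr0 // => k kj.
rewrite mcoeffZ mcoeffX; case: eqP => [/mnmP/(_ k)|]; rewrite ?mulr0 //.
by rewrite !mnm1E eqxx eq_sym (negPf kj).
Qed.

Lemma mcoeff0_subst_var i : (subst_var rho e i)@_0 = - e i.
Proof.
rewrite mcoeffB mcoeffC eqxx mulr1 raddf_sum /= big1 ?add0r // => k _.
by rewrite mcoeffZ mcoeffX -mdeg_eq0 mdeg1 mulr0.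
Qed.

Lemma semisubst_affineE Q : (forall m, (1 < mdeg m)%N -> Q@_m = 0) ->
  S Q = (f Q@_0)%:MP + \sum_i (f Q@_U_(i))%:MP * subst_var rho e i.
Proof.
move=> /mpoly_affineE {1}->; rewrite rmorphD rmorph_sum /= semisubstC.
by congr (_ + _); apply: eq_bigr => i _; rewrite rmorphM /= semisubstC semisubstXU.
Qed.

Lemma mcoeffU_semisubst_affine Q j : (forall m, (1 < mdeg m)%N -> Q@_m = 0) ->
  (S Q)@_U_(j) = \sum_i f Q@_U_(i) * rho i j.
Proof.
move=> /semisubst_affineE->; rewrite mcoeffD mcoeffC -mdeg_eq0 mdeg1.
rewrite mulr0 add0r raddf_sum /=; apply: eq_bigr => i _.
by rewrite mcoeffCM mcoeffU_subst_var.
Qed.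

Lemma mcoeff0_semisubst_affine Q : (forall m, (1 < mdeg m)%N -> Q@_m = 0) ->
  (S Q)@_0 = f Q@_0 - \sum_i f Q@_U_(i) * e i.
Proof.
move=> /semisubst_affineE->; rewrite mcoeffD mcoeffC eqxx mulr1 raddf_sum /=.
congr (_ + _); rewrite -sumrN; apply: eq_bigr => i _.
by rewrite mcoeffCM mcoeff0_subst_var mulrN.
Qed.

Variables (C : comNzRingType) (val : K -> C -> Prop) (w : 'I_n -> C) (u : K).
Hypothesis mulrnA_eq0 : forall (a : A) k, a *+ k.+1 = 0 -> a = 0.

Hypothesis valM : forall x y c d, val x c -> val y d -> val (x * y) (c * d).
Hypothesis val_rho : forall i j, val (rho i j) (if i == j then w i else 0).
Hypothesis mulw_neq0 : forall c i, c != 0 -> c * w i != 0.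

(* Differentiating a relation [u P = S P] replaces the family [Q] by the family
   of its partial derivatives and [M] by its product with the matrix [rho]. *)
Lemma semi_invariant_descent k (T : finType) (Q : T -> {mpoly A[n]})
    (M : T -> T -> K) (mu : T -> C) :
  (forall x, u *: map_mpoly g (Q x) = \sum_y M x y *: S (Q y)) ->
  (forall x y, val (M x y) (if x == y then mu x else 0)) ->
  (forall x, mu x != 0) ->
  (forall x m, (k.+1 < mdeg m)%N -> (Q x)@_m = 0) ->
  (exists x m, mdeg m = k.+1 /\ (Q x)@_m <> 0) ->
  exists (T : finType) (a : T -> 'I_n -> A) (b : T -> A) (M : T -> T -> K) (mu : T -> C),
  [/\ forall x y, val (M x y) (if x == y then mu x else 0),
      forall x, mu x != 0,
      exists x i, a x i <> 0,
      forall x j, u * g (a x j) = \sum_y M x y * \sum_i f (a y i) * rho i j &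
      forall x, u * g (b x) = \sum_y M x y * (f (b y) - \sum_i f (a y i) * e i)].
Proof.
elim: k T Q M mu => [|k IH] T Q M mu QM valMu mu0 Qdeg [x0 [m0 [m0k Qx0]]].
  exists T, (fun x i => (Q x)@_U_(i)), (fun x => (Q x)@_0), M, mu; split=> //.
  - have /mdeg1P[i /eqP m0i] : mdeg m0 == 1%N by rewrite m0k.
    by exists x0, i; rewrite -m0i.
  - move=> x j; have := congr1 (mcoeff U_(j)) (QM x).
    rewrite mcoeffZ mcoeff_map_mpoly => ->; rewrite raddf_sum /=.
    by apply: eq_bigr => y _; rewrite mcoeffZ mcoeffU_semisubst_affine //; apply: Qdeg.
  - move=> x; have := congr1 (mcoeff 0%MM) (QM x).
    rewrite mcoeffZ mcoeff_map_mpoly => ->; rewrite raddf_sum /=.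
    by apply: eq_bigr => y _; rewrite mcoeffZ mcoeff0_semisubst_affine //; apply: Qdeg.
have [i0 m0i0] : exists i, m0 i != 0%N.
  apply/existsP; rewrite -negb_forall; apply/negP => /forallP m00.
  by move: m0k; rewrite mdegE big1 // => i _; apply/eqP.
have m0E : m0 = (m0 - U_(i0) + U_(i0))%MM.
  rewrite submK //; apply/mnm_lepP => i; rewrite mnm1E.
  by case: eqP => // <-; rewrite lt0n.
apply: (IH (T * 'I_n)%type (fun x => (Q x.1)^`M(x.2))
  (fun x y => M x.1 y.1 * rho y.2 x.2) (fun x => mu x.1 * w x.2)).
- move=> [x j] /=; have := congr1 (mderiv j) (QM x).
  have -> : (u *: map_mpoly g (Q x))^`M(j) = u *: map_mpoly g (Q x)^`M(j).
    rewrite mderivZ; congr (_ *: _); apply/mpolyP => m.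
    by rewrite mcoeff_map_mpoly !mcoeff_deriv mcoeff_map_mpoly raddfMn.
  move=> ->; rewrite raddf_sum -(pair_bigA _ (fun y i => M x y * rho i j *: S (Q y)^`M(i))) /=.
  apply: eq_bigr => y _; rewrite mderivZ mderiv_semisubst scaler_sumr.
  by apply: eq_bigr => i _; rewrite scalerA.
- move=> [x j] [y i] /=; have := valM (valMu x y) (val_rho i j).
  rewrite xpair_eqE; have [<-|_] := eqVneq x y; rewrite ?mul0r //=.
  by have [->|_] := eqVneq i j; rewrite ?mulr0.
- by move=> [x j] /=; apply: mulw_neq0.
- move=> [x j] m /= km; rewrite mcoeff_deriv Qdeg ?mul0rn //.
  by rewrite mdegD mdeg1 addn1 ltnS.
- exists (x0, i0), (m0 - U_(i0))%MM; split=> /=.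
    by have := congr1 mdeg m0E; rewrite m0k mdegD mdeg1 addn1 => -[->].
  by rewrite mcoeff_deriv -m0E => /mulrnA_eq0.
Qed.

End SemilinearDescent.

Section Rescaling.
Variables (K : fieldType) (X : K).
Hypothesis X0 : X != 0.

Lemma rescale_eq u t N : u * X ^+ N / X ^+ (3 * N) * (t / X ^+ N) = u * t / X ^+ (3 * N).
Proof. by field; rewrite !expf_neq0. Qed.

Lemma rescale_gt u t N k :
  u * X ^+ N / X ^+ (3 * N) * (t / X ^+ (N + k.+1)) * X^-1 ^+ (2 * k).+2 =
  u * t / X ^+ (3 * (N + k.+1)).
Proof.
have E a d : (a / X ^+ d) * X^-1 = a / X ^+ d.+1 by rewrite exprSr invfM; ring.
rewrite exprVn (_ : 3 * (N + k.+1) = N + k.+1 + (2 * k).+2 + 2 * N)%N; last by lia.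
rewrite (_ : 3 * N = N + 2 * N)%N; last by lia.
rewrite (exprD _ (N + k.+1 + _)) (exprD _ (N + k.+1)) (exprD _ N (2 * N)).
move: (N + k.+1)%N (2 * k).+2 (2 * N)%N => p q r.
by field; rewrite ?expf_neq0.
Qed.

Lemma rescale_sum (I J : finType) (M : I -> K) (s : I -> J -> K) (r : J -> K) z :
  (\sum_y M y * \sum_i s y i * r i) * z = \sum_y M y * \sum_i r i * (s y i * z).
Proof.
rewrite mulr_suml; apply: eq_bigr => y _; rewrite -mulrA; congr (_ * _).
by rewrite mulr_suml; apply: eq_bigr => i _; ring.
Qed.

Lemma rescale_sumB (I J : finType) (M F : I -> K) (s : I -> J -> K) (e : J -> K) z z' c :
  z = z' * X^-1 * c ->
  (\sum_y M y * (F y - \sum_i s y i * e i)) * z =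
  \sum_y M y * (F y * z - (\sum_i s y i * z' * (e i / X)) * c).
Proof.
move=> ->; rewrite mulr_suml; apply: eq_bigr => y _; rewrite -mulrA; congr (_ * _).
rewrite mulrBl; congr (_ - _).
by rewrite !mulr_suml; apply: eq_bigr => i _; ring.
Qed.

Lemma exprV_split a d : (X ^+ (a + 1 + d))^-1 = (X ^+ a)^-1 * X^-1 * X^-1 ^+ d.
Proof. by rewrite !exprD expr1 exprVn; field; rewrite ?expf_neq0 ?X0. Qed.

End Rescaling.

Section NoLinearSemiInvariant.
Variables (C : numFieldType) (n : nat).
Local Notation A := {poly C}.
Local Notation K := (ratfun C).
Local Notation f := (@tofrac A \o comp_poly (branching C)).
Local Notation X := (@tofrac A 'X).
Variables (rho : 'I_n -> 'I_n -> K) (e : 'I_n -> K) (w : 'I_n -> C) (u : K).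
Hypothesis rho_inf : forall i j, infval (rho i j) (if i == j then w i else 0).
Hypothesis e_inf : forall i, infval (e i / X) (w i).
Hypothesis w_inj : injective w.
Hypothesis w_neq0 : forall i, w i != 0.

Lemma infval_branching (p : A) N : (size p <= N.+1)%N -> infval (f p / X ^+ (3 * N)) p`_N.
Proof.
move=> pN; rewrite -(coef_comp_branching pN); apply: infval_divXn.
exact: size_comp_branching.
Qed.

Lemma exists_max_size (I : finType) (F : I -> A) : (exists i, F i != 0) ->
  exists N, (forall i, (size (F i) <= N.+1)%N) /\ exists i, (F i)`_N != 0.
Proof.
move=> [i0 Fi0]; have [i _ iP] := arg_maxnP (fun i => size (F i)) (isT : xpredT i0).
have Fi : (0 < size (F i))%N by apply: leq_trans (iP i0 isT); rewrite lt0n size_poly_eq0.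
exists (size (F i)).-1; split=> [j|]; first by rewrite prednK //; apply: iP.
by exists i; rewrite -lead_coefE lead_coef_eq0 -size_poly_gt0.
Qed.

Lemma infval_sum_delta (I : finType) (F G : I -> K) (c d : I -> C) (x : I) :
  (forall y, infval (F y) (if x == y then d y else 0)) ->
  (forall y, infval (G y) (c y)) -> infval (\sum_y F y * G y) (d x * c x).
Proof.
move=> Fd Gc.
have -> : d x * c x = \sum_y (if x == y then d y else 0) * c y.
  rewrite (bigD1 x) //= eqxx big1 ?addr0 // => y.
  by rewrite eq_sym => /negPf->; rewrite mul0r.
by apply: infval_sum => y; apply: infvalM.
Qed.

(* At infinity the substitution multiplies degrees by 3, so the relation for [a]
   says that all the leading coefficients [l] satisfy [c l = mu w l] for one [c]. In the
   relation for [b] the terms in [e] then add up to degree exactly [3 N + 1], while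
   the terms in [b] cannot have leading degree [3 N + 1]. *)
Lemma no_linear_semi_invariant (T : finType) (a : T -> 'I_n -> A) (b : T -> A)
    (M : T -> T -> K) (mu : T -> C) :
  (forall x y, infval (M x y) (if x == y then mu x else 0)) ->
  (forall x, mu x != 0) ->
  (exists x i, a x i <> 0) ->
  (forall x j, u * tofrac (a x j) = \sum_y M x y * \sum_i f (a y i) * rho i j) ->
  (forall x, u * tofrac (b x) = \sum_y M x y * (f (b y) - \sum_i f (a y i) * e i)) ->
  False.
Proof.
move=> M_inf mu0 [x1 [i1 /eqP a1]] aE bE.
have X0 : X != 0 by rewrite tofrac_eq0 polyX_eq0.
have [N [aN [[x0 i0] /= a0]]] : exists N,
    (forall xi, size (a xi.1 xi.2) <= N.+1)%N /\ exists xi, (a xi.1 xi.2)`_N != 0.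
  by apply: exists_max_size; exists (x1, i1).
have {}M_inf x y : infval (M x y) (if x == y then mu y else 0).
  by have := M_inf x y; case: eqP => // ->.
have rho_inf' i j : infval (rho i j) (if j == i then w i else 0).
  by have := rho_inf i j; rewrite eq_sym.
pose sa x i := f (a x i) / X ^+ (3 * N).
have sa_inf x i : infval (sa x i) (a x i)`_N by apply/infval_branching/(aN (x, i)).
pose v := u * X ^+ N / X ^+ (3 * N).
have va x j : v * (tofrac (a x j) / X ^+ N) = \sum_y M x y * \sum_i rho i j * sa y i.
  by rewrite rescale_eq // aE rescale_sum.
have va_inf x j : infval (v * (tofrac (a x j) / X ^+ N)) (mu x * (w j * (a x j)`_N)).
  rewrite va; apply: (@infval_sum_delta T _ _ (fun y => w j * (a y j)`_N)) => // y.
  exact: (@infval_sum_delta _ _ _ (fun i => (a y i)`_N)).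
have a_inf x j : infval (tofrac (a x j) / X ^+ N) (a x j)`_N.
  exact/infval_divXn/(aN (x, j)).
pose c := mu x0 * w i0.
have v_inf : infval v c.
  have := infvalM (va_inf x0 i0) (infvalV a0 (a_inf x0 i0)).
  have t0 : tofrac (a x0 i0) / X ^+ N != 0.
    apply: contraNneq a0 => t0; have := a_inf x0 i0; rewrite t0.
    by move=> /infval_inj /(_ (infval0 C)) ->.
  by rewrite (mulfK t0) mulrA mulfK.
have lead_eq x j : (a x j)`_N != 0 -> mu x * w j = c.
  move=> axj; have := infval_inj (va_inf x j) (infvalM v_inf (a_inf x j)).
  by rewrite mulrA => /(mulIf axj).
have sum_a : \sum_i (a x0 i)`_N * w i = (a x0 i0)`_N * w i0.
  rewrite (bigD1 i0) //= big1 ?addr0 // => i ii0.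
  have [->|/lead_eq] := eqVneq (a x0 i)`_N 0; first by rewrite mul0r.
  by rewrite /c => /(mulfI (mu0 x0)) /w_inj ii0'; rewrite ii0' eqxx in ii0.
have sae_inf x : infval (\sum_i sa x i * (e i / X)) (\sum_i (a x i)`_N * w i).
  by apply: infval_sum => i; apply: infvalM.
have XV_inf k : infval (X^-1 ^+ k.+1) 0.
  by have := infvalX k.+1 (infvalXV C); rewrite expr0n.
have [bN|] := boolP [forall x, (size (b x) <= N.+1)%N].
  have {}bN x : (size (b x) <= N.+1)%N by move/forallP: bN.
  have vb : v * (tofrac (b x0) / X ^+ N) * X^-1 = \sum_y M x0 y *
      (f (b y) * ((X ^+ (3 * N))^-1 * X^-1) - (\sum_i sa y i * (e i / X)) * 1).
    by rewrite rescale_eq // bE -mulrA (rescale_sumB _ _ _ _ (esym (mulr1 _))).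
  have vb_inf : infval (v * (tofrac (b x0) / X ^+ N) * X^-1) (c * (b x0)`_N * 0).
    by apply: infvalM (infvalXV C); apply: infvalM => //; apply/infval_divXn/bN.
  have := infval_inj vb_inf; rewrite vb => H.
  have /H : infval (\sum_y M x0 y *
      (f (b y) * ((X ^+ (3 * N))^-1 * X^-1) - (\sum_i sa y i * (e i / X)) * 1))
      (mu x0 * ((b x0)`_N * 0 - (\sum_i (a x0 i)`_N * w i) * 1)).
    apply: (@infval_sum_delta T _ _ (fun y => (b y)`_N * 0 - (\sum_i (a y i)`_N * w i) * 1)) => // y.
    apply: infvalB; last by apply: infvalM => //; have := infvalC (1 : C); rewrite tofrac1.
    by rewrite mulrA; apply: infvalM (infvalXV C); apply: infval_branching.
  rewrite sum_a !mulr0 mulr1 sub0r => /esym/eqP; rewrite mulf_eq0 oppr_eq0 mulf_eq0.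
  by rewrite !(negPf (mu0 _), negPf a0, negPf (w_neq0 _)).
rewrite negb_forall => /existsP[x2]; rewrite -ltnNge => bx2.
have [N' [bN' [x3 b0]]] : exists N',
    (forall x, size (b x) <= N'.+1)%N /\ exists x, (b x)`_N' != 0.
  by apply: exists_max_size; exists x2; rewrite -size_poly_gt0 (leq_trans _ bx2).
have NN' : (N < N')%N by have := leq_trans bx2 (bN' x2).
pose k := (N' - N).-1.
have N'E : N' = (N + k.+1)%N by rewrite /k; lia.
have vb : v * (tofrac (b x3) / X ^+ N') * X^-1 ^+ (2 * k).+2 = \sum_y M x3 y *
    (f (b y) / X ^+ (3 * N') - (\sum_i sa y i * (e i / X)) * X^-1 ^+ (3 * k).+2).
  rewrite N'E rescale_gt // bE; apply: rescale_sumB.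
  by rewrite -exprV_split //; congr (_ ^+ _)^-1; lia.
have vb_inf : infval (v * (tofrac (b x3) / X ^+ N') * X^-1 ^+ (2 * k).+2) (c * (b x3)`_N' * 0).
  by apply: infvalM (XV_inf _); apply: infvalM => //; apply/infval_divXn/bN'.
have := infval_inj vb_inf; rewrite vb => H.
have /H : infval (\sum_y M x3 y *
    (f (b y) / X ^+ (3 * N') - (\sum_i sa y i * (e i / X)) * X^-1 ^+ (3 * k).+2))
    (mu x3 * ((b x3)`_N' - (\sum_i (a x3 i)`_N * w i) * 0)).
  apply: (@infval_sum_delta T _ _ (fun y => (b y)`_N' - (\sum_i (a y i)`_N * w i) * 0)) => // y.
  by apply: infvalB; [apply: infval_branching | apply: infvalM].
by rewrite !mulr0 subr0 => /esym/eqP; rewrite mulf_eq0 (negPf (mu0 _)) (negPf b0).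
Qed.

End NoLinearSemiInvariant.

(** * Relations with least leading monomial *)

Section LeadingMonomials.
Variables (A : comNzRingType) (K : fieldType) (f : {rmorphism A -> K}) (n k : nat).
Hypothesis f_inj : injective f.
Variable h : 'I_n -> {mpoly K[k]}.
Hypothesis h_neq0 : forall i, h i != 0.

Let lead (m : 'X_{1..n}) := (\sum_i mlead (h i) *+ m i)%MM.
Hypothesis lead_inj : injective lead.

Lemma mlead_mmap1 m : mlead (mmap1 h m) = lead m.
Proof.
rewrite /mmap1 mlead_prod => [|i _ _]; last exact: expf_neq0.
by apply: eq_bigr => i _; rewrite mleadX.
Qed.

Lemma mlead_mmap (P : {mpoly A[n]}) :
  mlead (mmap (@mpolyC k K \o f) h P) = (\join_(m <- msupp P) lead m)%O.
Proof.
have mleadE m : m \in msupp P -> mlead ((@mpolyC k K \o f) P@_m * mmap1 h m) = lead m.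
  move=> mP /=; rewrite mul_mpolyC mleadZ ?mlead_mmap1 //.
  by rewrite -(rmorph0 f) (inj_eq f_inj) -mcoeff_msupp.
rewrite /mmap mlead_sum; last first.
  rewrite filter_predT (_ : map _ _ = map lead (msupp P)); last exact/eq_in_map.
  by rewrite map_inj_uniq.
rewrite !big_seq; apply: eq_bigr => m; exact: mleadE.
Qed.

Lemma mmap_neq0 (P : {mpoly A[n]}) : P != 0 -> mmap (@mpolyC k K \o f) h P != 0.
Proof.
move=> P0; have [/hasP[m mP m0]|] := boolP (has (fun m => m != 0%MM) (msupp P)).
  apply: contraNneq m0 => SP0; have := mlead_mmap P; rewrite SP0 mlead0 => lead0.
  have lead00 : lead 0%MM = 0%MM by rewrite /lead big1 // => i _; rewrite mnm0E mulm0n.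
  apply/eqP/lead_inj; rewrite lead00; apply: le_anti; rewrite [in X in _ && X]le0x andbT lead0.
  exact: joins_sup_seq.
rewrite -all_predC => /allP /= msP.
have PE : P = (P@_0)%:MP.
  apply/mpolyP => m; rewrite mcoeffC; have [->|m0] := eqVneq m 0%MM; first by rewrite mulr1.
  rewrite mulr0; apply: memN_msupp_eq0; apply/negP => /msP.
  by rewrite negbK (negPf m0).
rewrite PE (mmapC _ (@mpolyC k K \o f)) /= mpolyC_eq0 -(rmorph0 f) (inj_eq f_inj).
by apply: contraNneq P0 => c0; rewrite PE c0 mpolyC0.
Qed.

End LeadingMonomials.

Section TriangularSubstitution.
Variables (A : comNzRingType) (K : fieldType) (f : {rmorphism A -> K}) (n : nat).
Hypothesis f_inj : injective f.

Lemma lem_mnm1 (i j : 'I_n) : (i <= j)%N -> (U_(j)%MM <= U_(i)%MM :> 'X_{1..n})%O.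
Proof.
rewrite leq_eqVlt => /orP[/eqP/val_inj->//|ij]; apply/ltW/ltmcP; first by rewrite !mdeg1.
exists i => [k ki|]; rewrite !mnm1E ?eqxx -!val_eqE /=.
  by rewrite !gtn_eqF // (ltn_trans ki).
by rewrite gtn_eqF.
Qed.

Variables (rho : 'I_n -> 'I_n -> K) (e : 'I_n -> K).
Hypothesis rho_trig : forall i j : 'I_n, (j < i)%N -> rho i j = 0.
Hypothesis rho_diag : forall i, rho i i != 0.

Lemma mlead_subst_var i : mlead (subst_var rho e i) = U_(i)%MM.
Proof.
have hU : U_(i)%MM \in msupp (subst_var rho e i).
  by rewrite mcoeff_msupp mcoeffU_subst_var.
apply/le_anti; rewrite msupp_le_mlead // andbT.
have /mlead_supp : subst_var rho e i != 0 by apply: contraTneq hU => ->; rewrite msupp0.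
move: (mlead _) => m; rewrite mcoeff_msupp.
have [m0|m0] := posnP (mdeg m).
  by move=> _; move/eqP: m0; rewrite mdeg_eq0 => /eqP->; apply: le0x.
have [/eqP/mdeg1P[j /eqP ->]|m1] := eqVneq (mdeg m) 1%N.
  rewrite mcoeffU_subst_var => rij; apply: lem_mnm1.
  by rewrite leqNgt; apply: contraNN rij => /rho_trig->.
rewrite mcoeffB mcoeffC -mdeg_eq0 (gtn_eqF m0) mulr0 subr0 raddf_sum /= big1 ?eqxx // => j _.
rewrite mcoeffZ mcoeffX; have [mj|_] := eqVneq U_(j)%MM m; last by rewrite mulr0.
by rewrite -mj mdeg1 eqxx in m1.
Qed.

Lemma subst_var_neq0 i : subst_var rho e i != 0.
Proof.
apply: contraTneq (rho_diag i) => h0.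
by rewrite -(mcoeffU_subst_var rho e) h0 mcoeff0 eqxx.
Qed.

Lemma lead_subst_var (m : 'X_{1..n}) :
  (\sum_i mlead (subst_var rho e i) *+ m i)%MM = m.
Proof.
by rewrite [RHS]multinomUE_id; apply: eq_bigr => i _; rewrite mlead_subst_var.
Qed.

Let lead_inj : injective (fun m : 'X_{1..n} =>
  (\sum_i mlead (subst_var rho e i) *+ m i)%MM).
Proof. by move=> m m'; rewrite !lead_subst_var. Qed.

Lemma mlead_semisubst (P : {mpoly A[n]}) : mlead (semisubst f rho e P) = mlead P.
Proof.
rewrite /semisubst mlead_mmap //; last exact: subst_var_neq0.
by apply: eq_bigr => m _; apply: lead_subst_var.
Qed.

Lemma semisubst_neq0 (P : {mpoly A[n]}) : P != 0 -> semisubst f rho e P != 0.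
Proof. apply: mmap_neq0 => //; exact: subst_var_neq0. Qed.

Variables (g : {rmorphism A -> K}) (L : comNzRingType) (ev : {rmorphism {mpoly K[n]} -> L}).
Hypothesis g_inj : injective g.
Hypothesis ev_semisubst : forall P : {mpoly A[n]},
  ev (map_mpoly g P) = 0 -> ev (semisubst f rho e P) = 0.
Hypothesis clear_denom : forall P : {mpoly K[n]},
  exists (q : K) (P' : {mpoly A[n]}), q != 0 /\ map_mpoly g P' = q *: P.

Lemma mlead_map_mpoly (P : {mpoly A[n]}) : mlead (map_mpoly g P) = mlead P.
Proof. exact: (perm_big _ (msupp_map_mpoly _ g_inj)). Qed.

Lemma mleadB_scaled (P Q : {mpoly K[n]}) : mlead P = mlead Q ->
  let D := mleadc Q *: P - mleadc P *: Q in D != 0 -> (mlead D < mlead P)%O.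
Proof.
move=> PQ D D0; rewrite lt_neqAle; apply/andP; split.
  apply: contraNneq D0 => DP; rewrite -mleadc_eq0 DP mcoeffB !mcoeffZ -PQ.
  by rewrite mulrC subrr.
apply: le_trans (mleadB_le _ _) _; rewrite leUx.
by rewrite (le_trans (mleadZ_le _ _)) //= PQ; apply: mleadZ_le.
Qed.

(* A relation of least leading monomial is proportional to its image, since a
   suitable combination of the two is a relation with a smaller leading monomial. *)
Lemma exists_semi_invariant (P : {mpoly K[n]}) : P != 0 -> ev P = 0 ->
  exists (u : K) (Q : {mpoly A[n]}),
    [/\ u *: map_mpoly g Q = semisubst f rho e Q, Q != 0 & (0 < mdeg (mlead Q))%N].
Proof.
elim/mleadrect: P => P IH P0 evP.
have evZ c Q : ev Q = 0 -> ev (c *: Q) = 0 by rewrite -mul_mpolyC rmorphM => ->; rewrite mulr0.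
have [q [Q [q0 QE]]] := clear_denom P.
have gQ0 : map_mpoly g Q != 0 by rewrite QE scaler_eq0 negb_or q0.
have Q0 : Q != 0 by apply: contraNneq gQ0 => ->; rewrite rmorph0.
have leadQ : mlead Q = mlead P by rewrite -mlead_map_mpoly QE mleadZ.
have evQ : ev (map_mpoly g Q) = 0 by rewrite QE evZ.
have evS := ev_semisubst evQ.
have leadS : mlead (map_mpoly g Q) = mlead (semisubst f rho e Q).
  by rewrite mlead_map_mpoly mlead_semisubst.
have := mleadB_scaled leadS; set D := _ - _ => /= ltD.
have [D0|D0] := eqVneq D 0; last first.
  apply: (IH D) => //; first by rewrite (lt_le_trans (ltD D0)) // mlead_map_mpoly leadQ.
  by rewrite rmorphB /= !evZ // subrr.
have S0 := semisubst_neq0 Q0.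
exists (mleadc (semisubst f rho e Q) / mleadc (map_mpoly g Q)), Q; split=> //.
  move/eqP: D0; rewrite subr_eq0 => /eqP D0.
  rewrite mulrC -scalerA D0 scalerA mulVf ?scale1r //.
  by rewrite mleadc_eq0.
rewrite lt0n mdeg_eq0; apply/negP => /eqP lead0.
have QC : map_mpoly g Q = ((map_mpoly g Q)@_0)%:MP.
  apply/mpolyP => m; rewrite mcoeffC; have [->|m0] := eqVneq m 0%MM; first by rewrite mulr1.
  by rewrite mulr0 mcoeff_gt_mlead // mlead_map_mpoly lead0 lt0x.
have c0 : (map_mpoly g Q)@_0 != 0 by apply: contraNneq gQ0; rewrite QC mcoeffC eqxx mulr1 => ->.
have := evZ ((map_mpoly g Q)@_0)^-1 _ evQ.
by rewrite {2}QC -mul_mpolyC -mpolyCM mulVf // rmorph1 => /eqP; rewrite oner_eq0.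
Qed.

End TriangularSubstitution.

(** * Composition of power series with t^2 + t^3 *)

Section PowerSeries.
Variable C : fieldType.
Implicit Types (g h : fps C) (p q : {poly C}).

Definition agree (n : nat) p g := forall i, (i <= n)%N -> p`_i = fps_coef g i.

Definition truncate n g : {poly C} := \poly_(i < n.+1) fps_coef g i.

Lemma agree_truncate n g : agree n (truncate n g) g.
Proof. by move=> i; rewrite coef_poly ltnS => ->. Qed.

Lemma agreeW m n p g : (m <= n)%N -> agree n p g -> agree m p g.
Proof. by move=> mn pg i im; apply: pg; apply: leq_trans mn. Qed.

Lemma agreeD n p q g h : agree n p g -> agree n q h -> agree n (p + q) (g + h).
Proof. by move=> pg qh i i_n; rewrite coefD pg // qh. Qed.

Lemma agreeM n p q g h : agree n p g -> agree n q h -> agree n (p * q) (g * h).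
Proof.
move=> pg qh i i_n; rewrite coefM fps_coefM; apply: eq_bigr => j _.
by rewrite pg ?qh // (leq_trans _ i_n) ?leq_subr // -ltnS.
Qed.

Lemma agree_deriv n p g : agree n.+1 p g -> agree n p^`() (fps_deriv g).
Proof. by move=> pg i i_n; rewrite coef_deriv pg. Qed.

Lemma agree_fps g h : (forall n, exists2 p, agree n p g & agree n p h) -> g = h.
Proof. by move=> gh; apply: fpsP => n; have [p <- // <-] := gh n. Qed.

Lemma fps_derivM g h : fps_deriv (g * h) = fps_deriv g * h + g * fps_deriv h.
Proof.
apply: agree_fps => n; exists (truncate n.+1 g * truncate n.+1 h)^`().
  by apply/agree_deriv/agreeM; apply: agree_truncate.
rewrite derivM; apply: agreeD; apply: agreeM.
- exact/agree_deriv/agree_truncate.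
- exact: agreeW (leqnSn n) (agree_truncate _).
- exact: agreeW (leqnSn n) (agree_truncate _).
- exact/agree_deriv/agree_truncate.
Qed.

Definition theta g := poly_fps 'X * fps_deriv g.

Lemma thetaM g h : theta (g * h) = theta g * h + g * theta h.
Proof. by rewrite /theta fps_derivM; ring. Qed.

Lemma theta_is_zmod_morphism : zmod_morphism theta.
Proof.
move=> g h; rewrite /theta -mulrBr; congr (_ * _); apply: fpsP => n /=.
by rewrite mulrnDl mulNrn.
Qed.

HB.instance Definition _ := GRing.isZmodMorphism.Build (fps C) (fps C) theta
  theta_is_zmod_morphism.

Lemma theta_poly_fps p : theta (poly_fps p) = poly_fps ('X * p^`()).
Proof.
rewrite rmorphM /theta; congr (_ * _); apply: fpsP => n /=.
by rewrite coef_deriv.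
Qed.

Lemma coef_branching_exp i n : (n < i)%N -> (branching C ^+ i)`_n = 0.
Proof.
move=> ni; have -> : branching C = 'X * ('X + 'X^2) by rewrite /branching; ring.
by rewrite exprMn coefXnM ni.
Qed.

Lemma agree_comp_branching n p q : (forall i, (i <= n)%N -> p`_i = q`_i) ->
  (p \Po branching C)`_n = (q \Po branching C)`_n.
Proof.
have trunc r : (r \Po branching C)`_n = \sum_(i < n.+1) r`_i * (branching C ^+ i)`_n.
  have [sr|sr] := leqP (size r) n.+1.
    rewrite coef_comp_poly (big_ord_widen _ (fun i => r`_i * (branching C ^+ i)`_n) sr).
    rewrite big_mkcond; apply: eq_bigr => i _; case: ltnP => // ri.
    by rewrite nth_default ?mul0r.
  rewrite coef_comp_poly (big_ord_widen _ (fun i => r`_i * (branching C ^+ i)`_n) (ltnW sr)).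
  rewrite [RHS]big_mkcond; apply: eq_bigr => i _; case: ltnP => // ri.
  by rewrite coef_branching_exp ?mulr0.
by move=> pq; rewrite !trunc; apply: eq_bigr => i _; rewrite pq // -ltnS.
Qed.

Definition fps_comp g : fps C := FPS (fun n => (truncate n g \Po branching C)`_n).

Lemma agree_comp n p g : agree n p g -> agree n (p \Po branching C) (fps_comp g).
Proof.
move=> pg i i_n /=; apply: agree_comp_branching => j ji.
by rewrite agree_truncate // pg // (leq_trans ji).
Qed.

Lemma fps_comp_poly p : fps_comp (poly_fps p) = poly_fps (p \Po branching C).
Proof. by apply: agree_fps => n; exists (p \Po branching C) => //; apply: agree_comp. Qed.

Lemma fps_comp_is_zmod_morphism : zmod_morphism fps_comp.
Proof.
move=> g h; have N f : fps_comp (- f) = - fps_comp f.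
  apply: fpsP => n /=; rewrite -coefN -raddfN /=; apply: agree_comp_branching => i i_n.
  by rewrite agree_truncate //= coefN agree_truncate.
rewrite -N; apply: agree_fps => n.
exists ((truncate n g + truncate n (- h)) \Po branching C).
  by apply/agree_comp/agreeD; apply: agree_truncate.
by rewrite comp_polyD; apply: agreeD; apply/agree_comp/agree_truncate.
Qed.

Lemma fps_comp_is_monoid_morphism : monoid_morphism fps_comp.
Proof.
split=> [|g h]; first by rewrite -(rmorph1 (@poly_fps C)) fps_comp_poly comp_polyC.
apply: agree_fps => n; exists ((truncate n g * truncate n h) \Po branching C).
  by apply/agree_comp/agreeM; apply: agree_truncate.
by rewrite comp_polyM; apply: agreeM; apply/agree_comp/agree_truncate.
Qed.

HB.instance Definition _ := GRing.isZmodMorphism.Build (fps C) (fps C) fps_comp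
  fps_comp_is_zmod_morphism.
HB.instance Definition _ := GRing.isMonoidMorphism.Build (fps C) (fps C) fps_comp
  fps_comp_is_monoid_morphism.

Lemma fps_deriv_comp g :
  fps_deriv (fps_comp g) = fps_comp (fps_deriv g) * poly_fps (branching C)^`().
Proof.
apply: agree_fps => n; exists (truncate n.+1 g \Po branching C)^`().
  exact/agree_deriv/agree_comp/agree_truncate.
rewrite deriv_comp; apply: agreeM => //.
exact/agree_comp/agree_deriv/agree_truncate.
Qed.

Lemma theta_comp g : poly_fps ('X + 1) * theta (fps_comp g) =
  poly_fps (3%:R *: 'X + 2%:R%:P) * fps_comp (theta g).
Proof.
rewrite /theta fps_deriv_comp rmorphM /= fps_comp_poly comp_polyX.
rewrite mulrCA mulrA [RHS]mulrA -!rmorphM mulrCA -rmorphM mulrC.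
congr (poly_fps _ * _); rewrite /branching derivD !derivXn -!scaler_nat -!mul_polyC.
by rewrite !polyC_natr; ring.
Qed.

End PowerSeries.

Definition dilation (C : nzRingType) : {poly C} := 3%:R *: 'X + 2%:R%:P.

Section ThetaRecursion.
Variables (C : numFieldType) (f : fps C).
Hypothesis f_comp : fps_comp f = f - poly_fps 'X.
Local Notation D := (dilation C).
Local Notation z := (fun i => iter i (@theta C) f).

Lemma theta_poly_mul (p : {poly C}) g :
  theta (poly_fps p * g) = poly_fps ('X * p^`()) * g + poly_fps p * theta g.
Proof. by rewrite thetaM theta_poly_fps. Qed.

Lemma theta_comp_step N (g rhs : fps C) :
  poly_fps (D ^+ N) * fps_comp g = rhs ->
  poly_fps (D ^+ N.+2) * fps_comp (theta g) =
    poly_fps ('X + 1) * (poly_fps D * theta rhs - poly_fps ((3 * N)%:R *: 'X) * rhs).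
Proof.
have dilation_deriv : D * ('X * (D ^+ N)^`()) = (3 * N)%:R *: 'X * D ^+ N.
  rewrite deriv_exp derivD derivC derivZ derivX addr0.
  case: N => [|N]; first by rewrite mulr0n muln0 scale0r !mulr0 mul0r.
  rewrite /= exprS -mulr_natr natrM -!mul_polyC !polyCM !polyC_natr; ring.
move=> <-; rewrite theta_poly_mul.
set P := poly_fps (D ^+ N); set d := poly_fps D; set b := poly_fps (_ *: _).
set T := poly_fps ('X * _); set w := fps_comp g; set a := poly_fps ('X + 1).
have dT : d * T = b * P by rewrite -!rmorphM dilation_deriv.
have aw : a * theta w = d * fps_comp (theta g) by rewrite theta_comp.
have -> : a * (d * (T * w + P * theta w) - b * (P * w)) =
    a * (d * T - b * P) * w + d * P * (a * theta w) by ring.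
rewrite dT subrr mulr0 mul0r add0r aw (_ : poly_fps (D ^+ N.+2) = d * d * P); first by ring.
by rewrite -!rmorphM -mulrA -!exprS.
Qed.

Lemma theta_comp_expansion i : exists (p : nat -> {poly C}) (q : {poly C}),
  [/\ poly_fps (D ^+ (2 * i)) * fps_comp (z i) =
        \sum_(j < i.+1) poly_fps (p j) * z j - poly_fps q,
      forall j, (i < j)%N -> p j = 0,
      forall j, (size (p j) <= (2 * i).+1)%N /\ (p j)`_(2 * i) = ((i == j)%:R * 3 ^+ i)%R,
      (size q <= (2 * i).+2)%N & q`_(2 * i).+1 = 3 ^+ i].
Proof.
elim: i => [|i [p [q [pqE pgt psize qsize qlead]]]].
  exists (fun j => (j == 0%N)%:R%:P), 'X; split.
  - by rewrite muln0 expr0 rmorph1 mul1r big_ord1 /= f_comp polyC1 rmorph1 mul1r.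
  - by move=> [|j].
  - by move=> [|j]; rewrite size_polyC_leq1 coefC /= expr0 mulr1.
  - by rewrite size_polyX.
  - by rewrite coefX expr0.
pose N := (2 * i)%N; pose p' j := if j is k.+1 then p k else 0.
exists (fun j => ('X + 1) * (D * ('X * (p j)^`() + p' j) - (3 * N)%:R *: 'X * p j)),
  (('X + 1) * (D * ('X * q^`()) - (3 * N)%:R *: 'X * q)).
have sX1 : (size ('X + 1 : {poly C})%R <= 2)%N by rewrite size_polyDl ?size_polyX ?size_poly1.
have sD : (size D <= 2)%N.
  rewrite /dilation (leq_trans (size_polyD _ _)) // geq_max.
  by rewrite (leq_trans (size_scale_leq _ _)) ?size_polyX // (leq_trans (size_polyC_leq1 _)).
have sX a : (size (a *: 'X : {poly C})%R <= 2)%N by rewrite (leq_trans (size_scale_leq _ _)) ?size_polyX.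
have sd (r : {poly C}) m : (size r <= m.+1)%N ->
    (size ('X * r^`())%R <= m.+1)%N /\ ('X * r^`())`_m = r`_m *+ m.
  move=> rm; split.
      apply/leq_sizeP => -[//|j] mj; rewrite coefXM /= coef_deriv.
    by rewrite nth_default ?mul0rn // (leq_trans rm).
  by case: m rm => [|m] rm; rewrite coefXM ?mulr0n //= coef_deriv.
have X1lead : ('X + 1 : {poly C})`_1 = 1 by rewrite coefD coefX coef1 addr0.
have Dlead : D`_1 = 3%:R by rewrite coefD coefZ coefX coefC mulr1 addr0.
have sp' j : (size (p' j) <= N.+1)%N by case: j => [|j]; rewrite ?size_poly0 //; case: (psize j).
have step (r r' : {poly C}) m : (size r <= m.+1)%N -> (size r' <= m.+1)%N ->
    (size (('X + 1) * (D * ('X * r^`() + r') - (3 * N)%:R *: 'X * r))%R <= m.+3)%N /\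
    (('X + 1) * (D * ('X * r^`() + r') - (3 * N)%:R *: 'X * r))`_m.+2 =
      3%:R * (r`_m *+ m + r'`_m) - (3 * N)%:R * r`_m.
  move=> rm r'm; have [sdr dr] := sd r m rm.
  have sdr' : (size ('X * r^`() + r')%R <= m.+1)%N.
    by rewrite (leq_trans (size_polyD _ _)) // geq_max sdr.
  have sB : (size (D * ('X * r^`() + r') - (3 * N)%:R *: 'X * r)%R <= m.+2)%N.
    rewrite (leq_trans (size_polyD _ _)) // geq_max size_polyN.
    by rewrite !(@size_mul_leq_add _ _ _ 1 m).
  split; first exact: (@size_mul_leq_add _ _ _ 1 m.+1).
  rewrite -[m.+2]/(1 + m.+1)%N coefM_top // X1lead mul1r coefB -[m.+1]/(1 + m)%N.
  by rewrite !coefM_top // Dlead coefD dr coefZ coefX mulr1.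
have s0 : (size (0%R : {poly C}) <= N.+2)%N by rewrite size_poly0.
split.
- rewrite mulnS (theta_comp_step pqE) raddfB /= theta_poly_fps raddf_sum /=.
  have -> : \sum_(j < i.+1) theta (poly_fps (p j) * z j) =
      \sum_(j < i.+2) poly_fps ('X * (p j)^`() + p' j) * z j.
    under eq_bigr do rewrite theta_poly_mul.
    under [RHS]eq_bigr do rewrite rmorphD mulrDl.
    rewrite !big_split /=; congr (_ + _).
      by rewrite [RHS]big_ord_recr /= pgt // deriv0 mulr0 rmorph0 mul0r addr0.
    by rewrite [RHS]big_ord_recl /= rmorph0 mul0r add0r.
  have -> : \sum_(j < i.+1) poly_fps (p j) * z j = \sum_(j < i.+2) poly_fps (p j) * z j.
    by rewrite [RHS]big_ord_recr /= pgt // rmorph0 mul0r addr0.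
  have morph (r r' : {poly C}) : poly_fps (('X + 1) * (D * r' - (3 * N)%:R *: 'X * r)) =
      poly_fps ('X + 1) * (poly_fps D * poly_fps r' - poly_fps ((3 * N)%:R *: 'X) * poly_fps r).
    by rewrite rmorphM rmorphB !rmorphM.
  under [X in _ = X - _]eq_bigr do rewrite morph.
  rewrite morph; move: (poly_fps ('X + 1)) (poly_fps D) (poly_fps (_ *: _)) => a d b.
  set s1 := \sum_(j < _) _; set s2 := \sum_(j < _) _; set s3 := \sum_(j < _) _.
  have -> : s3 = a * (d * s1 - b * s2).
    rewrite !mulr_sumr -sumrB mulr_sumr; apply: eq_bigr => j _; ring.
  by rewrite -/N; ring.
- by move=> [//|j] ij; rewrite /= !pgt // ?(ltn_trans _ ij) // deriv0 !mulr0 addr0 mulr0 subrr mulr0.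
- move=> j; have [sj lj] := psize j; have [s l] := step (p j) (p' j) N sj (sp' j).
  rewrite mulnS; split=> //; rewrite l lj.
  case: j {s l sj} lj => [|j] lj /=; last first.
    by rewrite (psize j).2 eqSS; rewrite -[_ *+ N]mulr_natl natrM exprS; ring.
  by rewrite coef0 -[_ *+ N]mulr_natl natrM; ring.
- have [s l] := step q 0%R N.+1 qsize s0.
  by rewrite mulnS; move: s l; rewrite !addr0.
- have [s l] := step q 0%R N.+1 qsize s0.
  rewrite mulnS; move: l; rewrite !addr0 => ->; rewrite qlead coef0 addr0.
  by rewrite -[_ *+ N.+1]mulr_natl natrM exprS -[N.+1]addn1 natrD; ring.
Qed.
End ThetaRecursion.

(** * Transcendence *)

Section Mmap.
Variables (n : nat) (B : comNzRingType).

Lemma mmap_ext (B' : comNzRingType) (f f' : B -> B') (h h' : 'I_n -> B') (P : {mpoly B[n]}) :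
  f =1 f' -> h =1 h' -> mmap f h P = mmap f' h' P.
Proof. by move=> ff hh; apply: eq_bigr => m _; rewrite ff (mmap1_eq _ hh). Qed.

Lemma rmorph_mmap (B1 B2 : comNzRingType) (phi : {rmorphism B1 -> B2}) (f : B -> B1)
    (h : 'I_n -> B1) (P : {mpoly B[n]}) :
  phi (mmap f h P) = mmap (phi \o f) (phi \o h) P.
Proof.
rewrite rmorph_sum; apply: eq_bigr => m _; rewrite rmorphM rmorph_prod /=.
by congr (_ * _); apply: eq_bigr => i _; rewrite rmorphXn.
Qed.

Lemma mmap_map_mpoly (B1 B2 : comNzRingType) (f : {rmorphism B -> B1})
    (phi : {rmorphism B1 -> B2}) (h : 'I_n -> B2) (P : {mpoly B[n]}) :
  mmap phi h (map_mpoly f P) = mmap (phi \o f) h P.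
Proof.
rewrite [LHS]rmorph_mmap; apply: mmap_ext => [b|i] /=; first by rewrite mmapC.
by rewrite mmapX mmap1U.
Qed.

Lemma mmap_subst_var (B1 : comNzRingType) (phi : {rmorphism B -> B1}) (h : 'I_n -> B1)
    (rho : 'I_n -> 'I_n -> B) (e : 'I_n -> B) i :
  mmap phi h (subst_var rho e i) = \sum_j phi (rho i j) * h j - phi (e i).
Proof.
rewrite mmapB mmapC raddf_sum /=; congr (_ - _); apply: eq_bigr => j _.
by rewrite mmapZ mmapX mmap1U.
Qed.

End Mmap.

Lemma affine_div (L : fieldType) (I : finType) (p z : I -> L) (q d c : L) :
  d != 0 -> d * c = \sum_j p j * z j - q -> \sum_j p j / d * z j - q / d = c.
Proof.
move=> d0 dc; apply: (mulfI d0); rewrite dc mulrBr mulr_sumr mulrCA divff // mulr1.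
congr (_ - _); apply: eq_bigr => j _.
by rewrite mulrA mulrCA divff // mulr1.
Qed.

Lemma ratfun_laurent_tofrac (C : fieldType) (p : {poly C}) :
  ratfun_laurent (tofrac p) = tofrac (poly_fps p).
Proof.
rewrite (@ratfun_laurentP _ _ p 1) ?oner_eq0 ?tofrac1 ?mulr1 //.
by rewrite (rmorph1 (@poly_fps C)) tofrac1 divr1.
Qed.

Lemma ratfun_laurent_div (C : fieldType) (p q : {poly C}) : q != 0 ->
  ratfun_laurent (tofrac p / tofrac q) = tofrac (poly_fps p) / tofrac (poly_fps q).
Proof.
by move=> q0; rewrite (@ratfun_laurentP _ _ p q) // divfK // tofrac_eq0.
Qed.

Lemma mpoly_clear_denom (C : fieldType) n (P : {mpoly (ratfun C)[n]}) :
  exists (q : ratfun C) (P' : {mpoly {poly C}[n]}),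
    q != 0 /\ map_mpoly (@tofrac {poly C}) P' = q *: P.
Proof.
suff [q [P' [q0 PE]]] : exists (q : {poly C}) (P' : {mpoly {poly C}[n]}),
    q != 0 /\ map_mpoly (@tofrac {poly C}) P' = tofrac q *: P.
  by exists (tofrac q), P'; rewrite tofrac_eq0.
elim/mpolyind: P => [|c m P _ _ [q [P' [q0 PE]]]].
  by exists 1, 0; rewrite oner_eq0 raddf0 scaler0.
have [a [b [b0 cb]]] : exists a b, b != 0 /\ c * tofrac b = tofrac a :> ratfun C.
  by exists \n_(repr c), \d_(repr c); split; [apply: denom_ratioP | apply: ratfun_numden].
exists (q * b), ((q * a) *: 'X_[m] + b *: P'); split; first by rewrite mulf_neq0.
rewrite raddfD /= !map_mpolyZ map_mpolyX PE scalerDr !scalerA /= !rmorphM /=.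
by rewrite -cb (mulrC (tofrac b)) [c * _]mulrC mulrA.
Qed.

Section ThetaTranscendence.
Variables (C : numFieldType) (f : fps C) (n : nat).
Hypothesis f_comp : fps_comp f = f - poly_fps 'X.
Local Notation A := {poly C}.
Local Notation K := (ratfun C).
Local Notation D := (dilation C).

(* The variable ['X_i] stands for [theta^(n-i) f], because ['X_0] is the largest
   variable in the monomial order of [mpoly]. *)
Let z (i : 'I_n.+1) := iter (n - i) (@theta C) f.

Lemma size_dilation_exp k : size (D ^+ k) = k.+1.
Proof.
have sD : size D = 2%N by rewrite /dilation -mul_polyC size_MXaddC polyC_eq0 pnatr_eq0 /= size_polyC pnatr_eq0.
have D0 : D != 0 by rewrite -size_poly_eq0 sD.
by rewrite (polySpred (expf_neq0 k D0)) size_exp sD mul1n.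
Qed.

Lemma coef_dilation_exp k : (D ^+ k)`_k = 3%:R ^+ k.
Proof.
have := lead_coef_exp D k; rewrite lead_coefE size_dilation_exp => ->.
congr (_ ^+ _); rewrite lead_coefE (size_dilation_exp 1) coefD coefZ coefX coefC.
by rewrite mulr1 addr0.
Qed.

Lemma theta_transcendental (P : {mpoly K[n.+1]}) : P != 0 ->
  mmap (@ratfun_laurent C) (fun i => tofrac (z i)) P != 0.
Proof.
move=> P0; apply/negP => /eqP evP.
have [p pE] := choice (theta_comp_expansion f_comp).
have {pE}[q pqE] := choice pE.
pose den i := D ^+ (2 * i).
have den0 i : den i != 0 by rewrite -size_poly_eq0 size_dilation_exp.
pose rho (i j : 'I_n.+1) := tofrac (p (n - i)%N (n - j)%N) / tofrac (den (n - i)%N).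
pose e (i : 'I_n.+1) := tofrac (q (n - i)%N) / tofrac (den (n - i)%N).
pose w (i : 'I_n.+1) : C := (3%:R ^+ (n - i)%N)^-1.
have three k : 3%:R ^+ k != 0 :> C by rewrite expf_neq0 // pnatr_eq0.
have w0 i : w i != 0 by rewrite invr_eq0.
have sq3 k : 3%:R ^+ (2 * k) = 3%:R ^+ k * 3%:R ^+ k :> C by rewrite -exprD addnn mul2n.
have subn_inj (i j : 'I_n.+1) : (n - i == n - j)%N = (i == j).
  by rewrite -val_eqE /=; have := ltn_ord i; have := ltn_ord j; lia.
have w_inj : injective w.
  move=> i j /invr_inj /eqP; rewrite -!natrX eqr_nat eqn_exp2l // subn_inj.
  by move/eqP.
have rho_inf i j : infval (rho i j) (if i == j then w i else 0).
  have [_ _ /(_ (n - j)%N) [sp lp] _ _] := pqE (n - i)%N.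
  apply: infval_div (size_dilation_exp _) sp _.
  rewrite lp coef_dilation_exp subn_inj sq3 /w.
  by case: eqP => _; rewrite ?mul0r // mul1r mulKf.
have e_inf i : infval (e i / tofrac 'X) (w i).
  have [_ _ _ sq lq] := pqE (n - i)%N.
  rewrite /e -mulrA -invfM -tofracM.
  apply: (@infval_div _ _ _ (2 * (n - i)).+1) sq _.
    by rewrite size_mulX ?size_dilation_exp.
  by rewrite lq coefMX coef_dilation_exp sq3 /w mulKf.
have rho_trig (i j : 'I_n.+1) : (j < i)%N -> rho i j = 0.
  move=> ji; have [_ pgt _ _ _] := pqE (n - i)%N.
  by rewrite /rho pgt ?tofrac0 ?mul0r //; have := ltn_ord i; lia.
have rho_diag i : rho i i != 0.
  apply: contraNneq (w0 i) => rii; have := rho_inf i i; rewrite eqxx rii.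
  by move/(infval_inj (infval0 C)) <-.
pose v (i : 'I_n.+1) : laurent C := tofrac (z i).
pose ev := mmap (@ratfun_laurent C) v.
pose evf (Q : {mpoly A[n.+1]}) : fps C := mmap (@poly_fps C) z Q.
pose sub := @tofrac A \o comp_poly (branching C).
have ev_semisubst (Q : {mpoly A[n.+1]}) :
    ev (map_mpoly (@tofrac A) Q) = 0 -> ev (semisubst sub rho e Q) = 0.
  have evE : ev (map_mpoly (@tofrac A) Q) = (@tofrac (fps C)) (evf Q).
    rewrite /ev mmap_map_mpoly rmorph_mmap; apply: mmap_ext => // a /=.
    exact: ratfun_laurent_tofrac.
  have evsE : ev (semisubst sub rho e Q) = (@tofrac (fps C)) (fps_comp (evf Q)).
    rewrite /ev /semisubst !rmorph_mmap; apply: mmap_ext => [a|i] /=.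
      by rewrite mmapC /= ratfun_laurent_tofrac fps_comp_poly.
    rewrite mmap_subst_var /rho /e /= ratfun_laurent_div //.
    under eq_bigr => j _ do rewrite /= ratfun_laurent_div //.
    have [pqi pgt _ _ _] := pqE (n - i)%N.
    apply: affine_div; first by rewrite tofrac_eq0 -(rmorph0 (@poly_fps C)) (inj_eq (@poly_fps_inj C)).
    rewrite -tofracM pqi rmorphB rmorph_sum /=; congr (_ - _).
    pose F j := tofrac (poly_fps (p (n - i)%N j)) * tofrac (iter j (@theta C) f) : laurent C.
    transitivity (\sum_(j < (n - i).+1) F j).
      by apply: eq_bigr => j _; rewrite tofracM.
    have ni : ((n - i).+1 <= n.+1)%N by rewrite ltnS leq_subr.
    rewrite (big_ord_widen _ F ni) big_mkcond (reindex_inj rev_ord_inj) /=.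
    apply: eq_bigr => j _; rewrite subSS /F; case: ltnP => // nij.
    by rewrite pgt // raddf0 tofrac0 mul0r.
  move=> evQ0; have /eqP : tofrac (evf Q) = 0 by rewrite -evE.
  rewrite tofrac_eq0 evsE => /eqP ->.
  by rewrite (rmorph0 (@fps_comp C)) tofrac0.
have tofrac_inj : injective (@tofrac A) by move=> a b /eqP; rewrite tofrac_eq => /eqP.
have sub_inj : injective sub.
  move=> a b /tofrac_inj /eqP; rewrite -subr_eq0 -rmorphB /= comp_poly_eq0 ?size_branching //.
  by rewrite subr_eq0 => /eqP.
have [u [Q [QE Q0 Qdeg]]] := @exists_semi_invariant _ _ sub _ sub_inj rho e rho_trig rho_diag
  (@tofrac A) _ ev tofrac_inj ev_semisubst (@mpoly_clear_denom C _) P P0 evP.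
have natA (a : A) k : a *+ k.+1 = 0 -> a = 0.
  by move/eqP; rewrite -scaler_nat scaler_eq0 pnatr_eq0 => /eqP.
have mulw (c : C) i : c != 0 -> c * w i != 0 by move=> c0; rewrite mulf_neq0.
have [|||||T [a [b [M [mu [M_inf mu0 a0 aE bE]]]]]] :=
  @semi_invariant_descent _ _ sub (@tofrac A) _ rho e _ (@infval C) w u natA
    (@infvalM C) rho_inf mulw (mdeg (mlead Q)).-1 unit (fun=> Q) (fun _ _ => 1) (fun=> 1).
- by move=> _; rewrite big_const card_unit /= addr0 scale1r QE.
- by move=> [] []; rewrite eqxx; have := infvalC (1 : C); rewrite tofrac1.
- by move=> _; rewrite oner_eq0.
- move=> _ m; rewrite prednK // => mQ; apply: mcoeff_gt_mlead.
  by apply: lt_mdeg_ltmc.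
- by exists tt, (mlead Q); rewrite prednK //; split=> //; apply/eqP; rewrite mleadc_eq0.
exact: (no_linear_semi_invariant rho_inf e_inf w_inj w0 M_inf mu0 a0 aE bE).
Qed.
End ThetaTranscendence.

Lemma deriv_theta_expansion (C : numFieldType) (f : fps C) i :
  exists c : nat -> {poly C},
  [/\ poly_fps 'X^i * iter i (@fps_deriv C) f =
        \sum_(j < i.+1) poly_fps (c j) * iter j (@theta C) f,
      forall j, (i < j)%N -> c j = 0 & c i = 1].
Proof.
elim: i => [|i [c [cE cgt ci]]].
  exists (fun j => (j == 0%N)%:R); split=> [|[|j]|] //.
  by rewrite big_ord1 expr0.
pose c' j := if j is k.+1 then c k else 0.
exists (fun j => 'X * (c j)^`() + c' j - i%:R%:P * c j); split=> [|[//|j] ij|]; last first.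
- by rewrite cgt // deriv0 !mulr0 add0r subr0.
- by rewrite /= !cgt ?(ltn_trans _ ij) // deriv0 !mulr0 addr0 subr0.
have -> : poly_fps 'X^(i.+1) * iter i.+1 (@fps_deriv C) f =
    theta (poly_fps 'X^i * iter i (@fps_deriv C) f) -
    poly_fps i%:R%:P * (poly_fps 'X^i * iter i (@fps_deriv C) f).
  rewrite theta_poly_mul.
  have -> : 'X * ('X^i)^`() = i%:R%:P * 'X^i :> {poly C}.
    rewrite derivXn -mulr_natl polyC_natr mulrCA; case: i {c cE cgt ci c'} => [|i].
      by rewrite !mul0r.
    by rewrite -exprS.
  by rewrite /theta exprSr !rmorphM /=; ring.
rewrite cE raddf_sum /=.
under eq_bigr do rewrite theta_poly_mul.
have -> : \sum_(j < i.+2) poly_fps ('X * (c j)^`() + c' j - i%:R%:P * c j) * iter j (@theta C) f =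
    \sum_(j < i.+2) poly_fps ('X * (c j)^`()) * iter j (@theta C) f +
    \sum_(j < i.+2) poly_fps (c' j) * iter j (@theta C) f -
    poly_fps i%:R%:P * \sum_(j < i.+2) poly_fps (c j) * iter j (@theta C) f.
  rewrite mulr_sumr -big_split -sumrB; apply: eq_bigr => j _ /=.
  by rewrite rmorphB rmorphD (rmorphM _ i%:R%:P) /=; ring.
rewrite [X in _ = X + _ - _]big_ord_recr [X in _ = _ - _ * X]big_ord_recr /= cgt //.
rewrite deriv0 mulr0 rmorph0 !mul0r !addr0 big_split /=; congr (_ + _ - _).
by rewrite [RHS]big_ord_recl /= rmorph0 mul0r add0r.
Qed.

Lemma differentially_transcendental_comp (C : numFieldType) (f : fps C) :
  fps_comp f = f - poly_fps 'X -> differentially_transcendental f.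
Proof.
move=> f_comp n P P0; have [c cE] := choice (deriv_theta_expansion f).
pose rho (i j : 'I_n.+1) : ratfun C := tofrac (c (n - i)%N (n - j)%N) / tofrac 'X^(n - i).
pose h (i : 'I_n.+1) := subst_var rho (fun=> 0) (rev_ord i).
have rho_trig (i j : 'I_n.+1) : (j < i)%N -> rho i j = 0.
  move=> ji; have [_ cgt _] := cE (n - i)%N.
  by rewrite /rho cgt ?tofrac0 ?mul0r //; have := ltn_ord i; lia.
have X0 i : 'X^i != 0 :> {poly C} by rewrite -size_poly_eq0 size_polyXn.
have rho_diag i : rho i i != 0.
  have [_ _ ci] := cE (n - i)%N.
  by rewrite /rho ci tofrac1 mul1r invr_eq0 tofrac_eq0.
have hlead i : mlead (h i) = U_(rev_ord i)%MM by apply: mlead_subst_var.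
have h0 i : h i != 0 by apply: subst_var_neq0.
have lead_inj : injective (fun m : 'X_{1..n.+1} => (\sum_i mlead (h i) *+ m i)%MM).
  move=> m m' mm; apply/mnmP => i; have /mnmP/(_ (rev_ord i)) := mm.
  have E (d : 'X_{1..n.+1}) : (\sum_i mlead (h i) *+ d i)%MM (rev_ord i) = d i.
    rewrite mnm_sumE (bigD1 i) //= big1 => [|j ji].
      by rewrite addn0 mulmnE hlead mnm1E eqxx mul1n.
    by rewrite mulmnE hlead mnm1E (inj_eq rev_ord_inj) (negPf ji).
  by rewrite !E.
have id_inj : injective (@idfun (ratfun C)) by [].
have := theta_transcendental f_comp (mmap_neq0 id_inj h0 lead_inj P0).
congr (_ != 0); rewrite rmorph_mmap /meval mmap_map_mpoly.
apply: mmap_ext => [a|i] /=; first by rewrite mmapC.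
have i_n : (i <= n)%N by rewrite -ltnS.
rewrite mmap_subst_var raddf0 /rho /= subSS subKn //.
under eq_bigr => j _ do rewrite ratfun_laurent_div //.
rewrite -[X in _ - X](mul0r (tofrac (poly_fps 'X^i))^-1); have [ciE cgt _] := cE i.
apply: affine_div; first by rewrite tofrac_eq0 -(rmorph0 (@poly_fps C)) (inj_eq (@poly_fps_inj C)).
rewrite subr0 -tofracM ciE rmorph_sum /=.
pose F j := tofrac (poly_fps (c i j)) * tofrac (iter j (@theta C) f) : laurent C.
transitivity (\sum_(j < i.+1) F j); first by apply: eq_bigr => j _; rewrite tofracM.
rewrite (big_ord_widen _ F (_ : i.+1 <= n.+1)%N) // big_mkcond (reindex_inj rev_ord_inj) /=.
apply: eq_bigr => j _; rewrite subSS /F; case: ltnP => // ij.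
by rewrite cgt // raddf0 tofrac0 mul0r.
Qed.

(** * Counting complete trees *)

Section CompleteTrees.
Local Notation S23 := (pred2 2%N 3%N).

Fixpoint words (T : Type) (s : seq T) (k : nat) : seq (seq T) :=
  if k is k'.+1 then [seq x :: l | x <- s, l <- words s k'] else [:: [::]].

Lemma mem_words (T : eqType) (s : seq T) k l :
  (l \in words s k) = (size l == k) && all (mem s) l.
Proof.
elim: k l => [|k IH] [|x l] //=.
  by apply/allpairsP => -[[y l'] [_ _ /=]].
rewrite eqSS andbCA -IH; apply/allpairsP/andP => [[[y l'] /= [ys l's [-> ->]]] //|[xs ls]].
by exists (x, l).
Qed.

Lemma uniq_words (T : eqType) (s : seq T) k : uniq s -> uniq (words s k).
Proof.
by move=> us; elim: k => //= k IH; apply: allpairs_uniq => // -[x l] [y m] _ _ [-> ->].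
Qed.

Fixpoint complete_trees_of_height (h : nat) : seq plane_tree :=
  if h is k.+1 then
    let s := complete_trees_of_height k in map Node (words s 2 ++ words s 3)
  else [:: Node [::]].

Lemma complete_trees_of_heightS h :
  complete_trees_of_height h.+1 =
  map Node (words (complete_trees_of_height h) 2 ++ words (complete_trees_of_height h) 3).
Proof. by []. Qed.

Lemma Node_inj : injective Node.
Proof. by move=> ts ts' []. Qed.

Lemma leaf_depths_neq_nil t : leaf_depths t != [::].
Proof. by rewrite -size_eq0 size_leaf_depths -lt0n num_leaves_gt0. Qed.

Lemma mem_complete_trees_of_height h t : (t \in complete_trees_of_height h) =
  is_S_tree S23 t && all (pred1 h) (leaf_depths t).
Proof.
elim: h t => [|h IH] [ts].
  rewrite mem_seq1 (inj_eq Node_inj); case: ts => [//|t ts] /=.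
  rewrite all_map; apply/esym/negbTE; rewrite negb_and; apply/orP; right.
  rewrite -has_predC /=; have := leaf_depths_neq_nil t.
  by case: (leaf_depths t).
rewrite complete_trees_of_heightS (mem_map Node_inj) mem_cat !mem_words -andb_orl; case: ts => [//|t ts].
have -> : is_S_tree S23 (Node (t :: ts)) =
  (size (t :: ts) \in S23) && all (is_S_tree S23) (t :: ts) by [].
have -> : leaf_depths (Node (t :: ts)) =
  map succn (flatten (map leaf_depths (t :: ts))) by [].
rewrite -andbA; congr (_ && _).
rewrite (eq_all IH) all_predI; congr (_ && _).
rewrite all_map; elim: (t :: ts) => //= u us ->.
by rewrite all_cat.
Qed.

Lemma uniq_complete_trees_of_height h : uniq (complete_trees_of_height h).
Proof.
elim: h => [//|h IH]; rewrite complete_trees_of_heightS (map_inj_uniq Node_inj) cat_uniq !uniq_words // andbT.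
apply/hasPn => l; rewrite mem_words => /andP[/eqP l3 _].
by change (l \notin words (complete_trees_of_height h) 2); rewrite mem_words l3.
Qed.

Lemma height_lt_num_leaves h t : t \in complete_trees_of_height h -> (h < num_leaves t)%N.
Proof.
elim: h t => [|h IH] [ts]; first by rewrite num_leaves_gt0.
rewrite complete_trees_of_heightS (mem_map Node_inj) mem_cat !mem_words.
case: ts => [|t [|u ts]] //=; rewrite -andb_orl => /andP[_ /andP[/IH ht _]].
have := num_leaves_gt0 u; rewrite /=; lia.
Qed.

Lemma num_complete_trees_sum m n : (m <= n)%N ->
  num_complete_trees S23 m =
  (\sum_(h < n.+1) count (fun t => num_leaves t == m) (complete_trees_of_height h))%N.
Proof.
move=> mn; pose T h := [seq t <- complete_trees_of_height h | num_leaves t == m].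
pose s := [seq t | h <- iota 0 n.+1, t <- T h].
have us : uniq s.
  apply: allpairs_uniq_dep; first exact: iota_uniq.
    by move=> h _; rewrite filter_uniq // uniq_complete_trees_of_height.
  move=> [h t] [h' t'] /allpairsPdep[k [u [_ uk [-> ->]]]] /allpairsPdep[k' [u' [_ uk' [-> ->]]]] /= uu'.
  move: uk uk'; rewrite !mem_filter !mem_complete_trees_of_height uu'.
  move=> /and3P[_ _ a] /and3P[_ _ a']; move: (leaf_depths_neq_nil u') a a'.
  by case: (leaf_depths u') => // d l _ /= /andP[/eqP<- _] /andP[/eqP-> _].
have sP t : reflect (exists h, (h <= n)%N /\ t \in T h) (t \in s).
  apply: (iffP allpairsPdep) => [[h [u [hn uh ->]]]|[h [hn th]]].
    by exists h; split=> //; move: hn; rewrite mem_iota ltnS.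
  by exists h, t; split=> //; rewrite mem_iota ltnS.
have size_s : size s =
    (\sum_(h < n.+1) count (fun t => num_leaves t == m) (complete_trees_of_height h))%N.
  rewrite size_allpairs_dep sumnE big_map -[iota 0 n.+1]/(index_iota 0 n.+1) big_mkord.
  by apply: eq_bigr => h _; rewrite size_filter.
clearbody s; rewrite /num_complete_trees -size_s.
suff -> : complete_trees S23 m = [set` [fset x in s]%fset]%classic.
  by rewrite set_fsetK card_fseq undup_id.
have fsE t : (t \in [fset x in s]%fset) = (t \in s) by rewrite inE.
apply/seteqP; split=> t; rewrite /= fsE.
  move=> [St ct tm].
  have [d dE] : exists d, all (pred1 d) (leaf_depths t).
    move: ct (leaf_depths_neq_nil t); rewrite /complete.
    by case: (leaf_depths t) => //= d l dl _; exists d; rewrite eqxx.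
  have td : t \in complete_trees_of_height d by rewrite mem_complete_trees_of_height St.
  apply/sP; exists d; split; last by rewrite mem_filter tm eqxx.
  by rewrite (leq_trans _ mn) // -tm ltnW // height_lt_num_leaves.
move=> /sP[h [_]]; rewrite mem_filter mem_complete_trees_of_height.
move=> /and3P[/eqP um Su au]; split=> //; rewrite /complete.
by case: (leaf_depths t) au => //= d l /andP[/eqP->].
Qed.

Section GeneratingPolynomial.
Variable C : numFieldType.

Definition leaf_poly (s : seq plane_tree) : {poly C} := \sum_(t <- s) 'X^(num_leaves t).

Lemma coef_leaf_poly s n :
  (leaf_poly s)`_n = (count (fun t => num_leaves t == n) s)%:R.
Proof.
rewrite /leaf_poly coef_sum -sum1_count natr_sum [RHS]big_mkcond.
by apply: eq_bigr => t _; rewrite coefXn eq_sym; case: eqP.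
Qed.

Lemma leaf_poly_words s k :
  \sum_(l <- words s k) 'X^(sumn (map num_leaves l)) = leaf_poly s ^+ k.
Proof.
elim: k => [|k IH] /=; first by rewrite big_seq1.
rewrite big_allpairs_dep exprS -IH /leaf_poly mulr_suml; apply: eq_bigr => t _.
by rewrite mulr_sumr; apply: eq_bigr => l _; rewrite exprD.
Qed.

Local Notation G h := (leaf_poly (complete_trees_of_height h)).

Lemma leaf_polyS h : G h.+1 = G h ^+ 2 + G h ^+ 3.
Proof.
rewrite /leaf_poly complete_trees_of_heightS big_map big_cat -!leaf_poly_words.
congr (_ + _); apply: eq_big_seq => l; rewrite mem_words; by case: l.
Qed.

Lemma leaf_poly0 : G 0 = 'X.
Proof. by rewrite /leaf_poly big_seq1 expr1. Qed.

Lemma leaf_poly_comp h : G h \Po branching C = G h.+1.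
Proof.
elim: h => [|h IH]; first by rewrite leaf_polyS leaf_poly0 comp_polyX.
by rewrite {1}leaf_polyS comp_polyD !rmorphXn /= IH -leaf_polyS.
Qed.

Local Notation f := (generating_function C (num_complete_trees S23)).

Lemma agree_leaf_poly n : agree n (\sum_(h < n.+1) G h) f.
Proof.
move=> i i_n /=; rewrite (num_complete_trees_sum i_n) natr_sum coef_sum.
by apply: eq_bigr => h _; rewrite coef_leaf_poly.
Qed.

Lemma complete_trees_functional_equation : fps_comp f = f - poly_fps 'X.
Proof.
apply: agree_fps => n; exists ((\sum_(h < n.+1) G h) \Po branching C).
  exact/agree_comp/agree_leaf_poly.
have -> : (\sum_(h < n.+1) G h) \Po branching C = \sum_(h < n.+2) G h - 'X.
  rewrite raddf_sum [in RHS]big_ord_recl leaf_poly0 addrC addKr.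
  by apply: eq_bigr => h _; rewrite /= leaf_poly_comp.
move=> i i_n; rewrite coefB /= (@agree_leaf_poly n.+1 i) //.
exact: leq_trans i_n _.
Qed.

End GeneratingPolynomial.
End CompleteTrees.

Local Close Scope ring_scope.

Theorem theorem1p1 (R : realType) :
  differentially_transcendental
    (generating_function (complex R) (num_complete_trees (pred2 2 3))).
Proof.
apply: differentially_transcendental_comp.
exact: complete_trees_functional_equation.
Qed.
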